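(* Let $r,s\ge 1$ be integers and let $S(r,s)=\Bbbk[x_1,\dots,x_{r+1}]\#\Bbbk[y_1,\dots,y_{s+1}]$ be the Segre product of two polynomial rings over an algebraically closed field $\Bbbk$ of positive characteristic; put $d=r+s+1=\dim S(r,s)$. For an integer $c$ with $-s\le c\le r$, let $s(c)$ denote the generalized $F$-signature of the conic divisorial ideal of $S(r,s)$ corresponding to $c$. Then $$s(c)=\frac{A_{c+s+1,d}}{d!},$$ where $A_{k,d}$ is the Eulerian number, i.e. the number of permutations in $\mathfrak{S}_d$ with exactly $k-1$ descents.
   Context: A descent of a permutation $w=w_1\cdots w_d\in\mathfrak{S}_d$ (one-line notation) is an index $i\in\{1,\dots,d-1\}$ with $w_i>w_{i+1}$. Let $p>0$ be the characteristic of $\Bbbk$. The Segre product $S(r,s)$ is the $\Bbbk$-algebra generated by all monomials $x_iy_j$. It is identified with the following toric (Hibi) ring $R$. Put $r_1=r$, $r_2=s$; take $\mathbb{R}^d$ with coordinates $X_0$ and $X_{i,j}$ ($i=1,2$, $1\le j\le r_i$), and linear forms $\sigma_{i,0}=X_0-X_{i,1}$, $\sigma_{i,j}=X_{i,j}-X_{i,j+1}$ for $1\le j\le r_i-1$, $\sigma_{i,r_i}=X_{i,r_i}$ ($i=1,2$). Then $R=\Bbbk[\{\mathbf{m}\in\mathbb{Z}^d:\sigma_{i,j}(\mathbf{m})\ge 0\text{ for all } i,j\}]$. Divisorial ideals: for a family of integers $\mathbf{a}=(a_{i,j})$, $T(\mathbf{a})$ is the $R$-module generated by all Laurent monomials with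 exponent vector $\mathbf{m}\in\mathbb{Z}^d$ such that $\sigma_{i,j}(\mathbf{m})\ge a_{i,j}$ for all $i,j$. It is a divisorial ideal, and is called conic if (up to isomorphism) $a_{i,j}=\lceil\sigma_{i,j}(\mathbf{x})\rceil$ for all $i,j$, for some $\mathbf{x}\in\mathbb{R}^d$. One has $\mathrm{Cl}(S(r,s))\cong\mathbb{Z}$, where $c\in\mathbb{Z}$ corresponds to the divisorial ideal $T(\mathbf{a})$ with $a_{1,0}=c$ and all other $a_{i,j}=0$. The conic divisorial ideals correspond one-to-one to the integers $c$ with $-s\le c\le r$. Generalized $F$-signature: for every $e\in\mathbb{N}$ the $R$-module $R^{1/p^e}$ is a finite direct sum of conic divisorial ideals; passing to the completion at the irrelevant maximal ideal, where the Krull-Schmidt property holds, the multiplicities are well defined. If $c_e(M)$ denotes the multiplicity of the conic divisorial ideal $M$ in $R^{1/p^e}$, the generalized $F$-signature of $M$ is $s(M,R)=\lim_{e\to\infty}c_e(M)/p^{ed}$ with $d=\dim R$. *)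

(* Defs.v *)
From HB Require Import structures.
From mathcomp Require Import all_boot all_order all_algebra perm.
From mathcomp Require Import all_classical all_reals all_analysis.
(* The notations of mpoly clash with those of mathcomp-analysis; we write
   mpoly n k for the ring of polynomials in n variables over k. *)
From mathcomp Require Import -(notations) mpoly.

Set Implicit Arguments.
Unset Strict Implicit.
Unset Printing Implicit Defensive.

Import Order.TTheory GRing.Theory Num.Theory.
Import numFieldNormedType.Exports.

Local Open Scope classical_set_scope.
Local Open Scope ring_scope.

Definition subalg_gen (K : nzRingType) (A : lalgType K) (G : set A) : set A :=
  [set v | forall B : {pred A},
     GRing.subalg_closed B -> (forall g, G g -> g \in B) -> v \in B].

Definition submod_gen (A : nzRingType) (V : lmodType A) (G : set V) : set V :=
  [set v | forall B : {pred V},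
     GRing.submod_closed B -> (forall g, G g -> g \in B) -> v \in B].

Definition subalg_pred (K : nzRingType) (A : lalgType K) (G : set A) :
  A -> bool := fun v => `[< subalg_gen G v >].

Definition submod_pred (A : nzRingType) (V : lmodType A) (G : set V) :
  V -> bool := fun v => `[< submod_gen G v >].

Lemma subalg_predP (K : nzRingType) (A : lalgType K) (G : set A) v :
  reflect (subalg_gen G v) (v \in subalg_pred G).
Proof. exact: asboolP. Qed.

Lemma submod_predP (A : nzRingType) (V : lmodType A) (G : set V) v :
  reflect (submod_gen G v) (v \in submod_pred G).
Proof. exact: asboolP. Qed.

Lemma subalg_gen_closed (K : nzRingType) (A : lalgType K) (G : set A) :
  GRing.subalg_closed (subalg_pred G).
Proof.
split=> [|c u v /subalg_predP Gu /subalg_predP Gv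
         |u v /subalg_predP Gu /subalg_predP Gv];
  apply/subalg_predP=> B Bc GB; case: (Bc) => B1 BL BM //.
  exact: BL (Gu B Bc GB) (Gv B Bc GB).
exact: BM (Gu B Bc GB) (Gv B Bc GB).
Qed.

Lemma subalg_pred_subring (K : nzRingType) (A : lalgType K) (G : set A) :
  GRing.subring_closed (subalg_pred G).
Proof. exact: GRing.subalg_closedBM (subalg_gen_closed G). Qed.

HB.instance Definition _ (K : nzRingType) (A : lalgType K) (G : set A) :=
  GRing.isSubringClosed.Build A (subalg_pred G) (subalg_pred_subring G).

Lemma submod_gen_closed (A : nzRingType) (V : lmodType A) (G : set V) :
  GRing.submod_closed (submod_pred G).
Proof.
split=> [|c u v /submod_predP Gu /submod_predP Gv];
  apply/submod_predP=> B Bc GB; case: (Bc) => B0 BL //.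
exact: BL (Gu B Bc GB) (Gv B Bc GB).
Qed.

HB.instance Definition _ (A : nzRingType) (V : lmodType A) (G : set V) :=
  GRing.isSubmodClosed.Build A V (submod_pred G) (submod_gen_closed G).

Definition dirsum (A : nzRingType) (I : finType) (M : I -> lmodType A) : Type :=
  {dffun forall i, M i}.

Section DirectSum.
Variables (A : nzRingType) (I : finType) (M : I -> lmodType A).
Implicit Types (f g h : {dffun forall i, M i}) (a b : A).

HB.instance Definition _ := Choice.copy (dirsum M) {dffun forall i, M i}.

Let add f g : {dffun forall i, M i} := [ffun i => f i + g i].
Let opp f : {dffun forall i, M i} := [ffun i => - f i].
Let zero : {dffun forall i, M i} := [ffun i => 0].
Let scale a f : {dffun forall i, M i} := [ffun i => a *: f i].

Let addA : associative add.
Proof. by move=> f g h; apply/ffunP=> i; rewrite !ffunE addrA. Qed.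
Let addC : commutative add.
Proof. by move=> f g; apply/ffunP=> i; rewrite !ffunE addrC. Qed.
Let add0 : left_id zero add.
Proof. by move=> f; apply/ffunP=> i; rewrite !ffunE add0r. Qed.
Let addN : left_inverse zero opp add.
Proof. by move=> f; apply/ffunP=> i; rewrite !ffunE addNr. Qed.

HB.instance Definition _ :=
  GRing.isZmodule.Build (dirsum M) addA addC add0 addN.

Let scaleA a b f : scale a (scale b f) = scale (a * b) f.
Proof. by apply/ffunP=> i; rewrite !ffunE scalerA. Qed.
Let scale1 : left_id 1 scale.
Proof. by move=> f; apply/ffunP=> i; rewrite !ffunE scale1r. Qed.
Let scaleDr : right_distributive scale add.
Proof. by move=> a f g; apply/ffunP=> i; rewrite !ffunE scalerDr. Qed.
Let scaleDl f a b : scale (a + b) f = add (scale a f) (scale b f).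
Proof. by apply/ffunP=> i; rewrite !ffunE scalerDl. Qed.

HB.instance Definition _ := GRing.Zmodule_isLmodule.Build A (dirsum M)
  scaleA scale1 scaleDr scaleDl.
End DirectSum.

(* The I-adic completion of M is the module of I-adic Cauchy sequences of M
    modulo null sequences, over the completion of the ring A. *)

Section Completion.
Variables (A : nzRingType) (I : set A).

Fixpoint adic (M : lmodType A) (n : nat) : set M :=
  if n is n'.+1 then submod_gen [set a *: u | a in I & u in @adic M n']
  else setT.

Definition adic_cauchy (M : lmodType A) (u : nat -> M) : Prop :=
  forall n, exists N, forall i j, (N <= i)%N -> (N <= j)%N ->
    adic n (u i - u j).

Definition adic_null (M : lmodType A) (u : nat -> M) : Prop :=
  forall n, exists N, forall i, (N <= i)%N -> adic n (u i).

(* phi acts on representatives: the second clause is linearity over the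
   completion of A, the third one says (given the second one) that the induced
   map between the completions is well defined and injective, and the last one
   that it is surjective. *)
Definition completion_iso (M N : lmodType A) : Prop :=
  exists phi : (nat -> M) -> (nat -> N),
  [/\ forall u, adic_cauchy u -> adic_cauchy (phi u),
      forall (a : nat -> A^o) (u v : nat -> M),
        adic_cauchy a -> adic_cauchy u -> adic_cauchy v ->
        adic_null (fun i =>
          phi (fun j => (a j : A) *: u j + v j) i
          - ((a i : A) *: phi u i + phi v i)),
      forall u, adic_cauchy u -> (adic_null (phi u) <-> adic_null u)
    & forall v, adic_cauchy v ->
        exists2 u, adic_cauchy u & adic_null (fun i => phi u i - v i)].

End Completion.

(* In characteristic p, an element z of A^{1/p^e} is represented by its
    power z^{p^e} in A, so that a acts as multiplication by a^{p^e}. *)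

Definition frobenius_root (A : comNzRingType) (p : nat) (pA : p \in [pchar A])
  (e : nat) : Type := A.

Section FrobeniusRoot.
Variables (A : comNzRingType) (p : nat) (pA : p \in [pchar A]) (e : nat).

HB.instance Definition _ := GRing.Zmodule.copy (frobenius_root pA e) A.

Let scale (a z : A) : A := a ^+ (p ^ e) * z.

Let scaleA a b z : scale a (scale b z) = scale (a * b) z.
Proof. by rewrite /scale exprMn mulrA. Qed.
Let scale1 : left_id 1 scale.
Proof. by move=> z; rewrite /scale expr1n mul1r. Qed.
Let scaleDr : right_distributive scale +%R.
Proof. by move=> a z t; rewrite /scale mulrDr. Qed.
Let scaleDl z a b : scale (a + b) z = scale a z + scale b z.
Proof.
by rewrite /scale exprDn_pchar ?mulrDl// pnatX (pnatE _ (pcharf_prime pA)) pA.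
Qed.

HB.instance Definition _ := GRing.Zmodule_isLmodule.Build A
  (frobenius_root pA e) scaleA scale1 scaleDr scaleDl.
End FrobeniusRoot.

(* The variables x_1, ..., x_{r+1} and y_1, ..., y_{s+1} are indexed by
    'I_r.+1 + 'I_s.+1, the variable x_{i+1} (resp. y_{i+1}) having index
    inl i (resp. inr i). *)

Section Segre.
Variables (k : fieldType) (r s : nat).

Definition xy_ring : Type := mpoly (r.+1 + s.+1) k.
HB.instance Definition _ := GRing.IntegralDomain.on xy_ring.
HB.instance Definition _ := GRing.Lalgebra.on xy_ring.

Definition xy_var (v : 'I_r.+1 + 'I_s.+1) : xy_ring :=
  mpolyX k (mnm1 (unsplit v)).

Definition segre_gens : set xy_ring :=
  [set f | exists i j, f = xy_var (inl i) * xy_var (inr j)].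

Record segre := Segre {
  segre_val :> xy_ring;
  _ : segre_val \in subalg_pred segre_gens }.

HB.instance Definition _ := [isSub for segre_val].
HB.instance Definition _ := [Choice of segre by <:].
HB.instance Definition _ := [SubChoice_isSubComNzRing of segre by <:].

Lemma segre_pchar p : p \in [pchar k] -> p \in [pchar segre].
Proof.
move=> pk; rewrite !inE (pcharf_prime pk) /=; apply/eqP/val_inj.
rewrite rmorph_nat rmorph0.
have -> : p%:R = (p%:R : k) *: (1 : xy_ring) by rewrite scaler_nat.
by rewrite (pcharf0 pk) scale0r.
Qed.

Definition irrelevant : set segre := [set f | mcoeff mnm0 (segre_val f) = 0].

(* A point of V^d, with d = r + s + 1, has coordinates X_0, X_{1,j}, X_{2,j};
   an index (i, j) with i = 1, 2 is encoded as inl j, resp. inr j. *)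
Record point (V : Type) := Point {
  pt0 : V;
  pt1 : 'I_r -> V;
  pt2 : 'I_s -> V }.

(* The sequence X_0, X_{i,1}, ..., X_{i,n}, 0 *)
Definition chain (V : zmodType) (n : nat) (x0 : V) (x : 'I_n -> V) (j : nat) :=
  if j is j'.+1 then oapp x 0 (insub j' : option 'I_n) else x0.

Definition sigma (V : zmodType) (m : point V) (v : 'I_r.+1 + 'I_s.+1) : V :=
  match v with
  | inl j => chain (pt0 m) (pt1 m) j - chain (pt0 m) (pt1 m) j.+1
  | inr j => chain (pt0 m) (pt2 m) j - chain (pt0 m) (pt2 m) j.+1
  end.

(* The field k(x, y) as a module over the Segre product *)
Definition xy_frac : Type := {fraction xy_ring}.
HB.instance Definition _ := GRing.Field.on xy_frac.

Section FracModule.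
Let scale (a : segre) (z : xy_frac) : xy_frac := tofrac (segre_val a) * z.

Let scaleA a b z : scale a (scale b z) = scale (a * b) z.
Proof. by rewrite /scale rmorphM mulrA. Qed.
Let scale1 : left_id 1 scale.
Proof. by move=> z; rewrite /scale rmorph1 mul1r. Qed.
Let scaleDr : right_distributive scale +%R.
Proof. by move=> a z t; rewrite /scale mulrDr. Qed.
Let scaleDl z a b : scale (a + b) z = scale a z + scale b z.
Proof. by rewrite /scale rmorphD mulrDl. Qed.

HB.instance Definition _ := GRing.Zmodule_isLmodule.Build segre xy_frac
  scaleA scale1 scaleDr scaleDl.
End FracModule.

(* The Laurent monomial with exponent vector m. The identification of the toric
   ring with the Segre product sends it to the monomial in x, y whose exponents
   are the sigma_{i,j}(m): the lattice points of the cone correspond to the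
   monomials of equal degree in x and in y. *)
Definition laurent (m : point int) : xy_frac :=
  \prod_v tofrac (xy_var v) ^ sigma m v.

Definition divisor := 'I_r.+1 + 'I_s.+1 -> int.

Definition divisorial_gens (a : divisor) : set xy_frac :=
  [set laurent m | m in [set m | forall v, a v <= sigma m v]].

Record divisorial (a : divisor) := Divisorial {
  divisorial_val :> xy_frac;
  _ : divisorial_val \in submod_pred (divisorial_gens a) }.

HB.instance Definition _ (a : divisor) := [isSub for @divisorial_val a].
HB.instance Definition _ (a : divisor) := [Choice of divisorial a by <:].
HB.instance Definition _ (a : divisor) :=
  [SubChoice_isSubZmodule of divisorial a by <:].
HB.instance Definition _ (a : divisor) :=
  [SubZmodule_isSubLmodule of divisorial a by <:].

Definition class_divisor (c : int) : divisor :=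
  fun v => if v == inl ord0 then c else 0.

Definition conic (R : realType) (a : divisor) : Prop :=
  exists x : point R, forall v, a v = Num.ceil (sigma x v).

Section FSignature.
Variables (R : realType) (p : nat) (pk : p \in [pchar k]).

(* m is the number of summands isomorphic to M in a decomposition of the
   completion of S^{1/p^e} into completed conic divisorial ideals; it is unique
   by the Krull-Schmidt property. *)
Definition is_multiplicity (e : nat) (M : lmodType segre) (m : nat) : Prop :=
  exists (n : nat) (a : 'I_n -> divisor),
    [/\ forall l, conic R (a l),
        completion_iso irrelevant
          (frobenius_root (segre_pchar pk) e)
          (dirsum (fun l => divisorial (a l) : lmodType segre))
      & m = #|[set l | `[< completion_iso irrelevant (divisorial (a l)) M >]]|].

Definition multiplicity (e : nat) (M : lmodType segre) : nat :=
  xget 0%N [set m | is_multiplicity e M m].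

(* d = r + s + 1 is the dimension of the Segre product. *)
Definition F_ratio (M : lmodType segre) (e : nat) : R :=
  (multiplicity e M)%:R / p%:R ^+ (e * (r + s + 1)).

Definition generalized_F_signature (M : lmodType segre) : R :=
  limn (F_ratio M).

End FSignature.
End Segre.

Definition descents (d : nat) (w : 'S_d) : nat :=
  #|[set i : 'I_d | [exists j : 'I_d, (j == i.+1 :> nat) && (w j < w i)%N]]|.

(* Permutations with exactly n - 1 descents, n >= 1 *)
Definition eulerian (n d : nat) : nat :=
  #|[set w : 'S_d | (descents w).+1 == n]|.

(* Main.v *)
(* The monomials of S^{1/q}, q = p^e, split according to their exponents w
   modulo q, w in [0, q)^{r+1} x [0, q)^{s+1}; the part of w is isomorphic to the
   conic divisorial ideal of class c(w), where q c(w) is the sum of the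
   x-exponents minus the sum of the y-exponents of w. So the multiplicity of the
   class c is the number of w with c(w) = c.

   For the uniqueness of the multiplicities, Krull-Schmidt is replaced by
   numerical invariants of a module M that only depend on M / I^2 M, I being the
   irrelevant ideal, hence on the completion: the dimensions in M / I M of the
   space of the u for which (y_{s+1}/y_1)^j u, resp. (x_{r+1}/x_1)^j u, stays in M (up to
   I^2 M). They are additive, and on divisorial ideals they count the minimal
   generators divisible by y_1^j, resp. x_1^j, which gives a triangular system
   in the multiplicities.

   Replacing the y-exponents by their reflections and dropping one exponent, the
   count becomes that of the z in [0, q)^d such that s + z_1 + ... + z_d lies in
   [q(c+s), q(c+s+1)). The partial sums y_i = s + z_1 + ... + z_i modulo q
   determine z, and each carry is a descent of s, y_1, ..., y_d. So we count the
   y with c+s descents, and up to O(q^{d-1}) these are the injective words whose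
   pattern is a permutation with c+s descents. *)
Require Import Defs.
From HB Require Import structures.
From mathcomp Require Import all_boot all_order all_algebra.
From mathcomp Require Import all_classical all_reals all_analysis.
From mathcomp Require Import perm zify ring lra.
From mathcomp Require Import -(notations) mpoly.

Set Implicit Arguments.
Unset Strict Implicit.
Unset Printing Implicit Defensive.

Import Order.TTheory GRing.Theory Num.Theory.
Import numFieldNormedType.Exports.

Local Open Scope classical_set_scope.
Local Open Scope ring_scope.
Local Arguments adic : simpl never.
Local Notation "m1 |+| m2" := (mnm_add m1 m2) (at level 50, left associativity).
Local Notation "m1 |-| m2" := (mnm_sub m1 m2) (at level 50, left associativity).

(** * Adic filtrations and completions *)

Section Adic.
Variables (A : comNzRingType) (I : set A).
Implicit Types M N : lmodType A.

Lemma adic0 M n : @adic A I M n 0.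
Proof. by case: n => [//|n] B [B0 _] _. Qed.

Lemma adicP M n a (u v : M) : adic I n u -> adic I n v -> adic I n (a *: u + v).
Proof.
case: n => [//|n] nu nv B Bc GB; case: (Bc) => _ BL.
exact: BL (nu B Bc GB) (nv B Bc GB).
Qed.

Lemma adicD M n (u v : M) : adic I n u -> adic I n v -> adic I n (u + v).
Proof. by move=> nu nv; rewrite -[u]scale1r; exact: adicP. Qed.

Lemma adicZ M n a (u : M) : adic I n u -> adic I n (a *: u).
Proof. by move=> nu; rewrite -[_ *: _]addr0; apply: adicP => //; exact: adic0. Qed.

Lemma adicN M n (u : M) : adic I n u -> adic I n (- u).
Proof. by rewrite -scaleN1r; exact: adicZ. Qed.

Lemma adicB M n (u v : M) : adic I n u -> adic I n v -> adic I n (u - v).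
Proof. by move=> nu nv; apply: adicD => //; exact: adicN. Qed.

Lemma adicBC M n (u v : M) : adic I n (u - v) -> adic I n (v - u).
Proof. by move/adicN; rewrite opprB. Qed.

Lemma adic_trans M n (v u w : M) :
  adic I n (u - v) -> adic I n (v - w) -> adic I n (u - w).
Proof. by move=> uv vw; rewrite -(subrK v u) -addrA; exact: adicD. Qed.

Lemma adic_eqv M n (u v : M) : adic I n (u - v) -> adic I n v -> adic I n u.
Proof. by move=> uv nv; rewrite -(subrK v u); exact: adicD. Qed.

Lemma adic_sum M n (J : finType) (F : J -> M) :
  (forall j, adic I n (F j)) -> adic I n (\sum_j F j).
Proof. by move=> nF; apply: big_ind => //; [exact: adic0 | exact: adicD]. Qed.

Lemma adic_genM M n a (u : M) : I a -> adic I n u -> adic I n.+1 (a *: u).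
Proof. by move=> Ia nu B Bc; apply; exists a => //; exists u. Qed.

(** Generated submodules are defined by testing against boolean predicates; [asbool] turns a
    property closed under linear combinations into such a test. *)
Lemma adic_ind M n (P : M -> Prop) : P 0 ->
  (forall a u v, P u -> P v -> P (a *: u + v)) ->
  (forall a u, I a -> adic I n u -> P (a *: u)) ->
  forall u, adic I n.+1 u -> P u.
Proof.
move=> P0 PD PG u /(_ (fun u => `[< P u >])) Pu; apply/asboolP/Pu.
  split; first exact/asboolP.
  by move=> a v w /asboolP Pv /asboolP Pw; apply/asboolP/PD.
by move=> g [a Ia [v nv <-]]; apply/asboolP/PG.
Qed.

Lemma adicSW M n (u : M) : adic I n.+1 u -> adic I n u.
Proof.
elim: n u => [//|n IHn]; apply: adic_ind; first exact: adic0.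
  by move=> a u v; exact: adicP.
by move=> a u Ia /IHn nu; apply: adic_genM.
Qed.

Lemma adicW M m n (u : M) : (m <= n)%N -> adic I n u -> adic I m u.
Proof.
elim: n => [|n IHn]; first by rewrite leqn0 => /eqP ->.
by rewrite leq_eqVlt => /predU1P[-> //|/IHn mn /adicSW].
Qed.

Lemma adic_linear M N (f : M -> N) n u :
  linear f -> adic I n u -> adic I n (f u).
Proof.
move=> fL.
have f0 : f 0 = 0.
  have := fL 1 0 0; rewrite !scale1r addr0 => f00.
  by apply: (addrI (f 0)); rewrite addr0 -f00.
elim: n u => [//|n IHn]; apply: adic_ind.
- by rewrite f0; exact: adic0.
- by move=> a u v nu nv; rewrite fL; exact: adicP.
- move=> a u Ia /IHn nu; rewrite -[a *: u]addr0 fL f0 addr0.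
  exact: adic_genM.
Qed.

(** A linear bijection and its inverse preserve the adic filtrations, so the inverse applied
    termwise to Cauchy sequences is an isomorphism of completions. *)
Lemma bij_linear_completion_iso M N (f : N -> M) :
  linear f -> bijective f -> completion_iso I M N.
Proof.
move=> fL [g fK gK].
have gL : linear g by move=> a u v; apply: (can_inj fK); rewrite fL !gK.
have B M1 M2 (h : M1 -> M2) : linear h -> forall u v, h (u - v) = h u - h v.
  by move=> hL u v; rewrite addrC -scaleN1r hL scaleN1r addrC.
exists (fun u i => g (u i)); split.
- move=> u cu n; have [N1 uN] := cu n; exists N1 => i j Ni Nj.
  by rewrite -B //; apply: adic_linear => //; exact: uN.
- by move=> a u v _ _ _ n; exists 0%N => i _; rewrite gL subrr; exact: adic0.
- move=> u _; split=> nu n; have [N1 uN] := nu n; exists N1 => i Ni.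
    by rewrite -[u i]gK; apply: adic_linear => //; exact: uN.
  by apply: adic_linear => //; exact: uN.
- move=> v cv; exists (fun i => f (v i)).
    move=> n; have [N1 vN] := cv n; exists N1 => i j Ni Nj.
    by rewrite -B //; apply: adic_linear => //; exact: vN.
  by move=> n; exists 0%N => i _; rewrite fK subrr; exact: adic0.
Qed.

(* psi represents an isomorphism between M / I^n M and N / I^n N. *)
Definition iso_mod n M N : Prop := exists psi : M -> N,
  [/\ forall a u v, adic I n (psi (a *: u + v) - (a *: psi u + psi v)),
      forall m u, (m <= n)%N -> (adic I m (psi u) <-> adic I m u)
    & forall v, exists u, adic I n (psi u - v)].

(** * Maps that are linear modulo [I^n] *)

Section ModuloLinear.
Variables (n : nat) (M N : lmodType A) (psi : M -> N).
Hypothesis psiP : forall a u v, adic I n (psi (a *: u + v) - (a *: psi u + psi v)).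

Lemma mod_linearB u v : adic I n (psi (u - v) - (psi u - psi v)).
Proof.
by have := psiP (-1) v u; rewrite !scaleN1r [- v + u]addrC [- psi v + _]addrC.
Qed.

Lemma mod_linear0 : adic I n (psi 0).
Proof.
have := psiP 1 0 0; rewrite !scale1r addr0 opprD addrA subrr add0r.
by move=> /adicN; rewrite opprK.
Qed.

Lemma mod_linearZ a u : adic I n (psi (a *: u) - a *: psi u).
Proof.
have := adicD (psiP a u 0) mod_linear0.
by rewrite addr0 opprD addrA subrK.
Qed.

Lemma mod_linear_sum (J : finType) (a : J -> A) (e : J -> M) :
  adic I n (psi (\sum_j a j *: e j) - \sum_j a j *: psi (e j)).
Proof.
pose R (x : M) (y : N) := adic I n (psi x - y).
rewrite -/(R _ _).
elim/big_rec2 : _ => [|j y x _ Rxy]; first by rewrite /R subr0; exact: mod_linear0.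
apply: adic_trans (psiP _ _ _) _.
by rewrite opprD addrACA subrr add0r.
Qed.
End ModuloLinear.

(** A choice [chi] of preimages modulo [I^n] inverts [psi]; it is linear modulo [I^n] because [psi]
    reflects the filtration. *)
Lemma iso_mod_sym n M N : iso_mod n M N -> iso_mod n N M.
Proof.
move=> [psi [psiL psiA psiS]].
have [chi chiP] := choice psiS.
have chi_adic u v : adic I n (psi u - psi v) -> adic I n (u - v).
  move=> uv; apply/(psiA n) => //; rewrite -[psi _](subrK (psi u - psi v)).
  by apply: adicD => //; exact: mod_linearB.
exists chi; split.
- move=> a u v; apply: chi_adic; apply: adic_trans (chiP _) _; apply: adicBC.
  apply: adic_trans (psiL _ _ _) _.
  rewrite opprD addrACA -scalerBr; exact: adicP.
- move=> m u mn; split.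
    move/(psiA m _ mn) => nu; rewrite -[u](subKr (psi (chi u))).
    by apply: adicB => //; apply: (adicW mn).
  move=> nu; apply/(psiA m _ mn); rewrite -[psi _](subrK u).
  by apply: adicD => //; exact: (adicW mn).
- by move=> u; exists (psi u); apply: chi_adic.
Qed.

Lemma iso_mod_trans n M N P : iso_mod n M N -> iso_mod n N P -> iso_mod n M P.
Proof.
move=> [psi [psiL psiA psiS]] [chi [chiL chiA chiS]].
exists (fun u => chi (psi u)); split.
- move=> a u v; apply: adic_trans (chiL _ _ _).
  apply: adic_eqv (adicBC (mod_linearB chiL _ _)) _.
  by apply/(chiA n).
- move=> m u mn; split=> [/(chiA _ _ mn)/(psiA _ _ mn)//|].
  by move=> /(psiA _ _ mn)/(chiA _ _ mn).
- move=> w; have [v vw] := chiS w; have [u uv] := psiS v; exists u.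
  apply: adic_trans vw; apply: adic_eqv (adicBC (mod_linearB chiL _ _)) _.
  by apply/(chiA n).
Qed.
End Adic.

(** * From isomorphic completions to isomorphic quotients, for finitely generated [I] *)

Section CompletionQuotients.
Variables (A : comNzRingType) (I : set A) (K : nat) (g : 'I_K -> A).
Hypothesis gI : forall i, I (g i).
Hypothesis gP : forall a, I a -> exists h : 'I_K -> A, a = \sum_i h i * g i.
Implicit Types M N : lmodType A.

(** Coefficients in [I] are expanded in the generators. The number of terms does not depend on [u],
    which later allows the passage to limits term by term. *)
Lemma adicS_sum M n (u : M) : adic I n.+1 u ->
  exists v : 'I_K -> M, (forall i, adic I n (v i)) /\ u = \sum_i g i *: v i.
Proof.
move: u; apply: adic_ind.
- exists (fun=> 0); split=> [i|]; first exact: adic0.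
  by rewrite big1 // => i _; rewrite scaler0.
- move=> a u v [u' [nu ->]] [v' [nv ->]].
  exists (fun i => a *: u' i + v' i); split=> [i|]; first exact: adicP.
  rewrite scaler_sumr -big_split; apply: eq_bigr => i _ /=.
  by rewrite scalerDr !scalerA mulrC.
- move=> a u /gP[h ->] nu; exists (fun i => h i *: u); split=> [i|].
    exact: adicZ.
  by rewrite scaler_suml; apply: eq_bigr => i _; rewrite scalerA mulrC.
Qed.

(** For a Cauchy sequence this says that its limit vanishes in [M / I^n M]. *)
Definition evadic M n (u : nat -> M) :=
  exists n0, forall i, (n0 <= i)%N -> adic I n (u i).

Lemma evadicD M n (u v : nat -> M) :
  evadic n u -> evadic n v -> evadic n (fun i => u i + v i).
Proof.
move=> [Nu nu] [Nv nv]; exists (maxn Nu Nv) => i.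
by rewrite geq_max => /andP[iu iv]; apply: adicD; [exact: nu | exact: nv].
Qed.

Lemma evadic_trans M n (v u w : nat -> M) : evadic n (fun i => u i - v i) ->
  evadic n (fun i => v i - w i) -> evadic n (fun i => u i - w i).
Proof.
move=> uv vw; have := evadicD uv vw; congr evadic.
by apply/funext => i; rewrite addrA subrK.
Qed.

Lemma evadicBC M n (u v : nat -> M) :
  evadic n (fun i => u i - v i) -> evadic n (fun i => v i - u i).
Proof. by move=> [n0 uv]; exists n0 => i /uv /adicBC. Qed.

Lemma evadic_eqv M n (u v : nat -> M) :
  evadic n (fun i => u i - v i) -> evadic n v -> evadic n u.
Proof.
move=> uv nv; have := evadicD uv nv; congr evadic.
by apply/funext => i; rewrite subrK.
Qed.

Lemma evadic_sumS M n (v : 'I_K -> nat -> M) : (forall j, evadic n (v j)) ->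
  evadic n.+1 (fun i => \sum_j g j *: v j i).
Proof.
move=> /choice[Nv nv]; exists (\max_j Nv j) => i /bigmax_leqP Ni.
by apply: adic_sum => j; apply: adic_genM => //; apply: nv; exact: Ni.
Qed.

Lemma cauchy_cst M (x : M) : adic_cauchy I (fun=> x).
Proof. by move=> n; exists 0%N => i j _ _; rewrite subrr; exact: adic0. Qed.

Lemma cauchyP M a (u v : nat -> M) : adic_cauchy I u -> adic_cauchy I v ->
  adic_cauchy I (fun i => a *: u i + v i).
Proof.
move=> cu cv n; have [Nu nu] := cu n; have [Nv nv] := cv n.
exists (maxn Nu Nv) => i j; rewrite !geq_max => /andP[iu iv] /andP[ju jv].
by rewrite opprD addrACA -scalerBr; apply: adicP; [exact: nu | exact: nv].
Qed.

Lemma cauchyB M (u v : nat -> M) : adic_cauchy I u -> adic_cauchy I v ->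
  adic_cauchy I (fun i => u i - v i).
Proof.
move=> cu cv; have := cauchyP (-1) cv cu; congr adic_cauchy.
by apply/funext => i; rewrite scaleN1r addrC.
Qed.

Lemma cauchy_sum M (v : 'I_K -> nat -> M) : (forall j, adic_cauchy I (v j)) ->
  adic_cauchy I (fun i => \sum_j g j *: v j i).
Proof.
move=> cv n; have [Nv nv] := choice (fun j => cv j n).
exists (\max_j Nv j) => i l /bigmax_leqP Ni /bigmax_leqP Nl.
rewrite -sumrB; apply: adic_sum => j; rewrite -scalerBr; apply: adicZ.
by apply: nv; [exact: Ni | exact: Nl].
Qed.

Lemma null_evadic M n (u : nat -> M) : adic_null I u -> evadic n u.
Proof. by move=> /(_ n). Qed.

(* A Cauchy sequence is equivalent to the partial sums of a series with terms
   in I^(n+1), I^(n+2), ..., each of which can be divided by the generators of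
   I; the quotients converge. *)
Lemma cauchy_divide M n (u : nat -> M) : adic_cauchy I u -> evadic n.+1 u ->
  exists v : 'I_K -> nat -> M, [/\ forall j, adic_cauchy I (v j),
    forall j, evadic n (v j) &
    adic_null I (fun i => u i - \sum_j g j *: v j i)].
Proof.
move=> cu [N0 nu].
have [Nu nuP] := choice cu.
(* Sampling times beyond [N0] and beyond the Cauchy thresholds of all orders up to [i + n + 1], so
   that consecutive samples differ by an element of [I^(i+n+1) M]. *)
pose t i := (N0 + i + \max_(l < i + n.+2) Nu l)%N.
have tN0 i : (N0 <= t i)%N by rewrite /t -addnA leq_addr.
have ti i : (i <= t i)%N by rewrite /t addnAC leq_addl.
have tNu i l : (l <= i + n.+1)%N -> (Nu l <= t i)%N.
  rewrite -ltnS -addnS => li; rewrite /t.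
  have := @leq_bigmax _ (fun l : 'I_(i + n.+2) => Nu l) (Ordinal li).
  by move=> /leq_trans; apply; exact: leq_addl.
have w0 : adic I n.+1 (u (t 0%N)) by apply: nu.
have wS i : adic I (i + n).+1 (u (t i.+1) - u (t i)).
  by apply: nuP; apply: tNu; lia.
have [v0 [v0n v0E]] := adicS_sum w0.
have [d dP] := choice (fun i => adicS_sum (wS i)).
(* Partial sums of the quotients of the first sample and of the successive differences; by [wE] they
   recombine to [u (t i)] exactly. *)
pose v j i := v0 j + \sum_(l < i) d l j.
have vS j i : v j i.+1 = v j i + d i j by rewrite /v big_ord_recr addrA.
have vB j m i : (m <= i)%N -> adic I (m + n) (v j i - v j m).
  elim: i => [|i IHi]; first by rewrite leqn0 => /eqP ->; rewrite subrr; exact: adic0.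
  rewrite leq_eqVlt => /predU1P[->|mi]; first by rewrite subrr; exact: adic0.
  rewrite vS addrAC; apply: adicD; first exact: IHi.
  by apply: (@adicW _ _ _ _ (i + n)); [rewrite leq_add2r|case: (dP i)].
have wE i : u (t i) = \sum_j g j *: v j i.
  elim: i => [|i IHi].
    by rewrite v0E; apply: eq_bigr => j _; rewrite /v big_ord0 addr0.
  rewrite -[u _](subrK (u (t i))); case: (dP i) => _ ->; rewrite IHi.
  rewrite -big_split; apply: eq_bigr => j _ /=.
  by rewrite -scalerDr vS addrC.
exists v; split.
- move=> j m; exists m => i i' mi mi'.
  apply: (@adicW _ _ _ _ (m + n)); first exact: leq_addr.
  by apply: adic_trans (vB j m i mi) _; apply: adicBC; exact: vB.
- move=> j; exists 0%N => i _; rewrite -[v j i](subrK (v j 0%N)).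
  apply: adicD; first exact: (vB j 0%N).
  by rewrite /v big_ord0 addr0.
- move=> m; exists (maxn (Nu m) m) => i; rewrite geq_max => /andP[Ni mi].
  rewrite -wE; apply: nuP => //; apply: tNu; lia.
Qed.

Section CompletionMap.
Variables (M N : lmodType A) (phi : (nat -> M) -> nat -> N).
Hypothesis phiC : forall u, adic_cauchy I u -> adic_cauchy I (phi u).
Hypothesis phiL : forall (a : nat -> A^o) (u v : nat -> M),
  adic_cauchy I a -> adic_cauchy I u -> adic_cauchy I v ->
  adic_null I (fun i => phi (fun j => (a j : A) *: u j + v j) i
                        - ((a i : A) *: phi u i + phi v i)).
Hypothesis phi0 : forall u, adic_cauchy I u ->
  (adic_null I (phi u) <-> adic_null I u).
Hypothesis phiS : forall v, adic_cauchy I v ->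
  exists2 u, adic_cauchy I u & adic_null I (fun i => phi u i - v i).

Lemma completion_mapP a u v : adic_cauchy I u -> adic_cauchy I v ->
  adic_null I (fun i => phi (fun j => a *: u j + v j) i
                        - (a *: phi u i + phi v i)).
Proof. by move=> cu cv; apply: (phiL (a := fun=> a)) => //; exact: cauchy_cst. Qed.

Lemma completion_mapB u v : adic_cauchy I u -> adic_cauchy I v ->
  adic_null I (fun i => phi (fun j => u j - v j) i - (phi u i - phi v i)).
Proof.
move=> cu cv; have := completion_mapP (-1) cv cu; congr adic_null.
apply/funext => i; rewrite scaleN1r [- _ + _]addrC; congr (phi _ i - _).
by apply/funext => j; rewrite scaleN1r addrC.
Qed.

Lemma completion_map_sum (v : 'I_K -> nat -> M) :
  (forall j, adic_cauchy I (v j)) ->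
  adic_null I (fun i => phi (fun i => \sum_j g j *: v j i) i
                        - \sum_j g j *: phi (v j) i).
Proof.
move=> cv.
have cs (s : seq 'I_K) : adic_cauchy I (fun i => \sum_(j <- s) g j *: v j i).
  elim: s => [|j s IHs].
    have := cauchy_cst (0 : M); congr adic_cauchy.
    by apply/funext => i; rewrite big_nil.
  have := cauchyP (g j) (cv j) IHs; congr adic_cauchy.
  by apply/funext => i; rewrite big_cons.
elim: (index_enum _) => [|j s IHs] n.
  have [_ /(_ _ n)[|n0 nP]] := phi0 (cauchy_cst (0 : M)).
    by move=> m; exists 0%N => i _; exact: adic0.
  exists n0 => i /nP; rewrite big_nil subr0; congr (adic I n (phi _ i)).
  by apply/funext => l; rewrite big_nil.
have [n1 n1P] := completion_mapP (g j) (cv j) (cs s) n.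
have [n2 n2P] := IHs n.
exists (maxn n1 n2) => i; rewrite geq_max => /andP[/n1P i1 /n2P i2].
rewrite big_cons (_ : (fun i => _) =
  (fun i => g j *: v j i + \sum_(j0 <- s) g j0 *: v j0 i)).
  apply: adic_trans i1 _.
  by rewrite opprD addrACA subrr add0r.
by apply/funext => l; rewrite big_cons.
Qed.

(** Compatibility with the filtrations is deduced from linearity: up to a null sequence, [u] is a
    combination of the generators with coefficient sequences eventually in [I^n M], and [phi]
    carries it to the same combination of their images. *)
Lemma completion_map_evadic n u :
  adic_cauchy I u -> evadic n u -> evadic n (phi u).
Proof.
elim: n u => [|n IHn] u cu nu; first by exists 0%N.
have [v [cv nv uv]] := cauchy_divide cu nu.
have csv := cauchy_sum cv.
have duv := cauchyB cu csv.
have phi_sum := evadic_eqv (completion_map_sum cv n.+1)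
  (evadic_sumS (fun j => IHn _ (cv j) (nv j))).
apply: evadic_eqv _ phi_sum; apply: evadic_eqv _ ((phi0 duv).2 uv n.+1).
exact/evadicBC/completion_mapB.
Qed.

(** Here [phi u] is divided by the generators, the quotients are lifted by surjectivity, and
    injectivity modulo null sequences identifies [u] with the recombined lifts. *)
Lemma completion_map_evadic_inj n u :
  adic_cauchy I u -> evadic n (phi u) -> evadic n u.
Proof.
elim: n u => [|n IHn] u cu nu; first by exists 0%N.
have [v [cv nv uv]] := cauchy_divide (phiC cu) nu.
have /choice[w wP] j : exists w, adic_cauchy I w /\
    adic_null I (fun i => phi w i - v j i).
  by have [w] := phiS (cv j); exists w.
have cw j : adic_cauchy I (w j) by case: (wP j).
have nw j : evadic n (w j).
  by apply: IHn => //; apply: evadic_eqv _ (nv j); exact: (wP j).2.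
have csw := cauchy_sum cw.
apply: evadic_eqv _ (evadic_sumS nw); apply/null_evadic.
apply/(phi0 (cauchyB cu csw)) => m.
apply: evadic_eqv (completion_mapB cu csw m) _.
apply: evadic_trans (uv m) _.
apply: evadic_trans (evadicBC (completion_map_sum cw m)).
apply: evadic_eqv _ (_ : evadic m (fun i => \sum_j g j *: (v j i - phi (w j) i))).
  exists 0%N => i _.
  under [X in _ - X]eq_bigr do rewrite scalerBr.
  by rewrite sumrB subrr; exact: adic0.
have [n0 n0P] := choice (fun j => (wP j).2 m).
exists (\max_j n0 j) => i /bigmax_leqP ni; apply: adic_sum => j.
by apply/adicZ/adicBC/n0P/ni.
Qed.

Lemma completion_map_iso_mod n : iso_mod I n M N.
Proof.
have /choice[ix ixP] x : exists i0, forall i, (i0 <= i)%N ->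
    adic I n (phi (fun=> x) i - phi (fun=> x) i0).
  have [i0 i0P] := phiC (cauchy_cst x) n; exists i0 => i ii0.
  exact: i0P.
(* The image of a constant sequence is Cauchy; [psi x] is its term at an index from which it is
   constant modulo [I^n]. *)
pose psi x := phi (fun=> x) (ix x).
have psiE x : evadic n (fun i => phi (fun=> x) i - psi x).
  by exists (ix x) => i; exact: ixP.
have psi_adic m u : (m <= n)%N -> adic I m (psi u) <-> adic I m u.
  move=> mn; have psiE' : evadic m (fun i => phi (fun=> u) i - psi u).
    by have [n0 n0P] := psiE u; exists n0 => i /n0P /(adicW mn).
  split=> nu.
    have : evadic m (phi (fun=> u)).
      by apply: evadic_eqv psiE' _; exists 0%N.
    by move/(completion_map_evadic_inj (cauchy_cst u)) => [i /(_ _ (leqnn i))].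
  have nc : evadic m (fun=> u) by exists 0%N.
  have := evadic_eqv (evadicBC psiE') (completion_map_evadic (cauchy_cst u) nc).
  by move=> [i /(_ _ (leqnn i))].
exists psi; split => //.
- move=> a u v.
  suff : evadic n (fun=> psi (a *: u + v) - (a *: psi u + psi v)).
    by move=> [i /(_ _ (leqnn i))].
  apply: evadic_trans (evadicBC (psiE _)) _.
  apply: evadic_trans (completion_mapP a (cauchy_cst u) (cauchy_cst v) n) _.
  have [n1 n1P] := psiE u; have [n2 n2P] := psiE v.
  exists (maxn n1 n2) => i; rewrite geq_max => /andP[/n1P un /n2P vn].
  by rewrite opprD addrACA -scalerBr; exact: adicP.
- move=> v; have [u cu uv] := phiS (cauchy_cst v).
  have [i0 /(_ _ i0 _ (leqnn i0)) uP] := cu n.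
  exists (u i0).
  suff : evadic n (fun=> psi (u i0) - v) by move=> [i /(_ _ (leqnn i))].
  apply: evadic_trans (uv n); apply: evadic_trans (evadicBC (psiE _)) _.
  apply: evadicBC; apply: evadic_eqv
    (evadicBC (completion_mapB cu (cauchy_cst (u i0)) n)) _.
  apply: completion_map_evadic; first exact: cauchyB (cauchy_cst _).
  by exists i0.
Qed.
End CompletionMap.

Lemma completion_iso_mod n M N : completion_iso I M N -> iso_mod I n M N.
Proof.
by move=> [phi [phiC phiL phi0 phiS]]; exact: (completion_map_iso_mod phiC phiL).
Qed.
End CompletionQuotients.

(** * Ranks detected by division chains *)

Section DirectSumTheory.
Variables (A : nzRingType) (J : finType) (M : J -> lmodType A).

Definition dirsum_proj j (f : dirsum M) : M j := f j.

Lemma dirsum_proj_is_linear j : linear (dirsum_proj j).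
Proof. by move=> a f g; rewrite /dirsum_proj !ffunE. Qed.

HB.instance Definition _ j :=
  GRing.isLinear.Build A (dirsum M) (M j) *:%R (dirsum_proj j)
    (@dirsum_proj_is_linear j).

Definition dirsum_inj j (u : M j) : dirsum M :=
  [ffun i => if eqVneq j i is EqNotNeq e then ecast i (M i) e u else 0].

Lemma dirsum_inj_is_linear j : linear (@dirsum_inj j).
Proof.
move=> a u v; apply/ffunP => i; rewrite !ffunE.
by case: eqVneq => [e|_]; [case: i / e | rewrite scaler0 addr0].
Qed.

HB.instance Definition _ j :=
  GRing.isLinear.Build A (M j) (dirsum M) *:%R (@dirsum_inj j)
    (@dirsum_inj_is_linear j).

Lemma dirsum_injE j (u : M j) : dirsum_inj u j = u.
Proof.
by rewrite ffunE; case: eqVneq => [e|/eqP//]; rewrite eq_axiomK.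
Qed.

Lemma dirsum_injE0 j i (u : M j) : j != i -> dirsum_inj u i = 0.
Proof. by move=> ji; rewrite ffunE; case: eqVneq ji. Qed.

Lemma dirsum_sum (f : dirsum M) : f = \sum_j dirsum_inj (f j).
Proof.
apply/ffunP => i; rewrite -/(dirsum_proj i (\sum_j _)) raddf_sum (bigD1 i) //=.
rewrite /dirsum_proj dirsum_injE big1 ?addr0 // => j ji.
exact: dirsum_injE0.
Qed.
End DirectSumTheory.

Lemma adic_dirsum (A : comNzRingType) (I : set A) (J : finType)
  (M : J -> lmodType A) n (f : dirsum M) :
  adic I n f <-> forall j, adic I n (f j).
Proof.
split=> [nf j|nf].
  apply: (@adic_linear _ _ _ _ (@dirsum_proj _ _ M j)) => //.
  exact: dirsum_proj_is_linear.
rewrite (dirsum_sum f); apply: adic_sum => j.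
apply: (@adic_linear _ _ _ _ (@dirsum_inj _ _ M j)) => //.
exact: dirsum_inj_is_linear.
Qed.

(** * Ranks over the residue field and their invariance *)

Section Rank.
Variables (A : comNzRingType) (k : fieldType) (eps : {rmorphism A -> k}).
Let I : set A := [set a | eps a = 0].
Implicit Types M N : lmodType A.

(* P is meant to contain I M; then #|J| is the dimension of P / I M over A / I. *)
Definition has_rank M (P : set M) (J : finType) := exists e : J -> M,
  [/\ forall j, P (e j),
      forall u, P u -> exists a, adic I 1 (u - \sum_j a j *: e j)
    & forall a, adic I 1 (\sum_j a j *: e j) -> forall j, eps (a j) = 0].

Lemma eps_coef_unique M (J : finType) (e : J -> M) (a b : J -> A) :
  (forall c, adic I 1 (\sum_j c j *: e j) -> forall j, eps (c j) = 0) ->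
  adic I 1 (\sum_j a j *: e j - \sum_j b j *: e j) ->
  forall j, eps (a j) = eps (b j).
Proof.
move=> e_free ab j; apply/eqP; rewrite -subr_eq0 -rmorphB; apply/eqP.
apply: (e_free (fun j => a j - b j)).
by under eq_bigr do rewrite scalerBl; rewrite sumrB.
Qed.

(** Expressing each family through the other and applying [eps] gives matrices over [k] whose
    product [B *m C] is the identity, by freeness of [e]; this forces the inequality of sizes. *)
Lemma has_rank_leq M (P : set M) (J J' : finType) :
  has_rank P J -> has_rank P J' -> (#|J| <= #|J'|)%N.
Proof.
move=> [e [eP e_gen e_free]] [e' [e'P e'_gen _]].
have [b bP] := choice (fun j => e'_gen _ (eP j)).
have [c cP] := choice (fun j => e_gen _ (e'P j)).
pose B := \matrix_(i < #|J|, l < #|J'|) eps (b (enum_val i) (enum_val l)).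
pose C := \matrix_(i < #|J'|, l < #|J|) eps (c (enum_val i) (enum_val l)).
apply: (@mulmx1_min _ _ _ B C); apply/matrixP => i l; rewrite !mxE.
pose bc j := \sum_l b (enum_val i) l * c l j.
transitivity (eps (bc (enum_val l))).
  rewrite rmorph_sum (reindex_onto enum_rank enum_val) /=; last first.
    by move=> x _; exact: enum_valK.
  apply: eq_big => [x|x _]; first by rewrite enum_rankK eqxx.
  by rewrite !mxE enum_rankK rmorphM.
rewrite (eps_coef_unique (b := fun j => (enum_val i == j)%:R) e_free).
  by rewrite rmorph_nat (inj_eq enum_val_inj).
rewrite [X in _ - X](bigD1 (enum_val i)) //= eqxx scale1r.
rewrite [X in _ - (_ + X)]big1 ?addr0 => [|j /negPf]; last first.
  by rewrite eq_sym => ->; rewrite scale0r.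
apply: adicBC; apply: adic_trans (bP _) _.
have -> : \sum_j bc j *: e j = \sum_l b (enum_val i) l *: \sum_j c l j *: e j.
  under [RHS]eq_bigr do rewrite scaler_sumr.
  rewrite exchange_big; apply: eq_bigr => j _; rewrite scaler_suml.
  by apply: eq_bigr => x _; rewrite scalerA.
rewrite -sumrB; apply: adic_sum => x; rewrite -scalerBr.
exact/adicZ/cP.
Qed.

Lemma has_rank_unique M (P : set M) (J J' : finType) :
  has_rank P J -> has_rank P J' -> #|J| = #|J'|.
Proof. by move=> PJ PJ'; apply/eqP; rewrite eqn_leq !(has_rank_leq (P := P)). Qed.

(* The elements u = u_0 for which there are u_1, ..., u_n with
   g u_i = h u_(i+1) modulo I^2, that is, (g/h)^n u stays in the module to first
   order. *)
Fixpoint quot_chain M (g h : A) n : set M :=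
  if n is n'.+1 then
    [set u | exists2 v, quot_chain g h n' v & adic I 2 (g *: u - h *: v)]
  else setT.

Section Transport.
Variables (M N : lmodType A) (psi : M -> N) (g h : A).
Hypothesis psiL : forall a u v, adic I 2 (psi (a *: u + v) - (a *: psi u + psi v)).
Hypothesis psiA : forall m u, (m <= 2)%N -> (adic I m (psi u) <-> adic I m u).
Hypothesis psiS : forall v, exists u, adic I 2 (psi u - v).

Lemma quot_chain_adic n (u v : N) :
  adic I 2 (u - v) -> quot_chain g h n u -> quot_chain g h n v.
Proof.
case: n => [//|n] uv [w nw uw]; exists w => //.
by apply: adic_trans uw; rewrite -scalerBr; apply/adicZ/adicBC.
Qed.

(** Only [g *: u - h *: v] modulo [I^2] enters the chain condition, and [psi] commutes with this
    expression modulo [I^2]; witnesses in [N] are lifted by surjectivity. *)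
Lemma quot_chain_iso n u : quot_chain g h n (psi u) <-> quot_chain g h n u.
Proof.
have psiB x y : adic I 2 (psi (g *: x - h *: y) - (g *: psi x - h *: psi y)).
  apply: adic_trans (mod_linearB psiL _ _) _.
  rewrite opprD addrACA -opprD; apply: adicB; exact: mod_linearZ.
elim: n u => [//|n IHn] u; split=> -[v nv uv].
  have [w wv] := psiS v; exists w.
    by apply/IHn; apply: quot_chain_adic nv; exact: adicBC.
  apply/(psiA (m := 2)) => //; apply: adic_eqv (psiB _ _) _.
  apply: adic_eqv uv; rewrite opprD opprK addrACA subrr add0r addrC -scalerBr.
  exact/adicZ/adicBC.
exists (psi v); first exact/IHn.
by apply: adic_eqv (adicBC (psiB _ _)) _; exact/psiA.
Qed.

(** This makes the rank an invariant of the quotient modulo [I^2], hence of the completion. *)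
Lemma has_rank_iso n (J : finType) :
  has_rank (quot_chain (M := M) g h n) J -> has_rank (quot_chain (M := N) g h n) J.
Proof.
move=> [e [eP e_gen e_free]]; exists (fun j => psi (e j)); split.
- by move=> j; apply/quot_chain_iso.
- move=> v nv; have [u uv] := psiS v.
  have [|a ua] := e_gen u.
    by apply/quot_chain_iso; apply: quot_chain_adic nv; exact: adicBC.
  exists a; apply: (adic_trans (v := psi u)); first exact/adicSW/adicBC.
  apply: (adic_trans (v := psi (\sum_j a j *: e j))); last first.
    exact/adicSW/(mod_linear_sum psiL).
  apply: (adic_eqv (v := psi (u - \sum_j a j *: e j))); last exact/psiA.
  exact/adicSW/adicBC/(mod_linearB psiL).
- move=> a na; apply: e_free; apply/(psiA (m := 1)) => //.
  apply: adic_eqv na; exact/adicSW/(mod_linear_sum psiL).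
Qed.
End Transport.

Lemma quot_chain_dirsum (J : finType) (M : J -> lmodType A) g h n (f : dirsum M) :
  quot_chain g h n f <-> forall j, quot_chain g h n (f j).
Proof.
elim: n f => [//|n IHn] f; split=> [[v /IHn nv /adic_dirsum fv] j|].
  by exists (v j) => //; have := fv j; rewrite !ffunE.
move=> fP; have vP j : exists v, quot_chain g h n v /\ adic I 2 (g *: f j - h *: v).
  by have [v] := fP j; exists v.
pose v : dirsum M := [ffun j => sval (cid (vP j))].
have vE j : v j = sval (cid (vP j)) by rewrite ffunE.
exists v; first by apply/IHn => j; rewrite vE; case: cid => ? [].
apply/adic_dirsum => j; rewrite !ffunE; case: cid => ? [].
by [].
Qed.

(** Additivity of the rank: the families of the summands are concatenated, indexed by tagged
    pairs. *)
Lemma has_rank_dirsum (J : finType) (M : J -> lmodType A) g h n (K : J -> finType) :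
  (forall j, has_rank (quot_chain (M := M j) g h n) (K j)) ->
  has_rank (quot_chain (M := dirsum M) g h n) {j : J & K j}.
Proof.
move=> MK; pose e j := sval (cid (MK j)).
have eP j : [/\ forall i, quot_chain g h n (e j i),
      forall u, quot_chain g h n u -> exists a, adic I 1 (u - \sum_i a i *: e j i)
    & forall a, adic I 1 (\sum_i a i *: e j i) -> forall i, eps (a i) = 0].
  exact: svalP (cid (MK j)).
pose E (x : {j : J & K j}) : dirsum M := dirsum_inj (e (tag x) (tagged x)).
have EE (a : {j : J & K j} -> A) j :
    (\sum_x a x *: E x) j = \sum_i a (Tagged K i) *: e j i.
  rewrite -/(dirsum_proj j _) raddf_sum /=.
  transitivity
    (\sum_j' \sum_(i : K j') a (Tagged K i) *: dirsum_proj j (E (Tagged K i))).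
    rewrite (sig_big_dep xpredT (fun _ _ => true)
      (fun j' i => a (Tagged K i) *: dirsum_proj j (E (Tagged K i)))).
    by apply: eq_big => -[j' i] //= _; rewrite linearZ.
  rewrite (bigD1 j) //= [X in _ + X]big1 ?addr0 => [|j' jj'].
    by apply: eq_bigr => i _; rewrite /dirsum_proj dirsum_injE.
  by apply: big1 => i _; rewrite /dirsum_proj /= dirsum_injE0 ?scaler0.
exists E; split.
- move=> [j i]; apply/quot_chain_dirsum => j'.
  have [<-|jj'] := eqVneq j j'; first by rewrite dirsum_injE; case: (eP j).
  rewrite dirsum_injE0 //.
  elim: n {MK e eP E EE} => [//|n IHn]; exists 0 => //.
  by rewrite !scaler0 subrr; exact: adic0.
- move=> f /quot_chain_dirsum nf.
  have aP j : exists a, adic I 1 (f j - \sum_i a i *: e j i).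
    by case: (eP j) => _ + _; apply.
  exists (fun x => sval (cid (aP (tag x))) (tagged x)).
  apply/adic_dirsum => j; rewrite -/(dirsum_proj j _) raddfB /= /dirsum_proj EE /=.
  by case: cid.
- move=> a /adic_dirsum na [j i]; case: (eP j) => _ _ /(_ (fun i => a (Tagged K i))).
  by apply; rewrite -EE.
Qed.
End Rank.

(** * Polynomials and the Segre product *)

Section Bidegree.
Variables (r s : nat).
Implicit Types (m : multinom (r.+1 + s.+1)) (v : 'I_r.+1 + 'I_s.+1).

Definition degx m := (\sum_(i < r.+1) m (unsplit (inl i)))%N.
Definition degy m := (\sum_(j < s.+1) m (unsplit (inr j)))%N.
(** The number of factors [x_i y_j] that can be split off; it measures the order of a monomial in
    the filtration by powers of the irrelevant ideal. *)
Definition mindeg m := minn (degx m) (degy m).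
(** A grading by the integers whose part of degree 0 is the Segre product and whose part of degree
    [c] is a divisorial ideal of class [c], up to isomorphism. *)
Definition bidiff m : int := (degy m)%:Z - (degx m)%:Z.

Lemma degxD m1 m2 : degx (m1 |+| m2) = (degx m1 + degx m2)%N.
Proof. by rewrite -big_split; apply: eq_bigr => i _; rewrite mnmDE. Qed.

Lemma degyD m1 m2 : degy (m1 |+| m2) = (degy m1 + degy m2)%N.
Proof. by rewrite -big_split; apply: eq_bigr => i _; rewrite mnmDE. Qed.

Lemma bidiffD m1 m2 : bidiff (m1 |+| m2) = bidiff m1 + bidiff m2.
Proof. by rewrite /bidiff degxD degyD; lia. Qed.

Lemma mdeg_degxy m : mdeg m = (degx m + degy m)%N.
Proof. by rewrite mdegE big_split_ord. Qed.

Lemma mnm_le_mdeg m v : (m (unsplit v) <= mdeg m)%N.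
Proof. by rewrite mdegE (bigD1 (unsplit v)) //= leq_addr. Qed.

(** One of the two degrees vanishes, so the total degree is the other one. *)
Lemma mindeg0_mdeg m : mindeg m = 0%N -> mdeg m = absz (bidiff m).
Proof. by rewrite mdeg_degxy /bidiff /mindeg; lia. Qed.

Lemma unsplit_eq v w : (unsplit v == unsplit w) = (v == w).
Proof. exact/inj_eq/(can_inj unsplitK). Qed.

Lemma degx_mnm1 v : degx (mnm1 (unsplit v)) = if v is inl _ then 1%N else 0%N.
Proof.
rewrite /degx; case: v => [i|j].
  rewrite (bigD1 i) // mnm1E eqxx big1 ?addn0 // => i' ii'.
  rewrite mnm1E unsplit_eq; apply/eqP; rewrite eqb0.
  by apply: contra ii' => /eqP[->].
by apply: big1 => i _; rewrite mnm1E unsplit_eq.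
Qed.

Lemma degy_mnm1 v : degy (mnm1 (unsplit v)) = if v is inl _ then 0%N else 1%N.
Proof.
have := mdeg1 (unsplit v); rewrite mdeg_degxy degx_mnm1; case: v => [i|j].
  by move=> [].
by rewrite add0n.
Qed.

Lemma degx0 : degx mnm0 = 0%N.
Proof. by apply: big1 => i _; rewrite mnm0E. Qed.

Lemma degy0 : degy mnm0 = 0%N.
Proof. by apply: big1 => i _; rewrite mnm0E. Qed.

Lemma degx_gt0 m : (0 < degx m)%N -> exists i, (0 < m (unsplit (inl i)))%N.
Proof.
by rewrite lt0n sum_nat_eq0 negb_forall => /existsP[i]; rewrite /= -lt0n; exists i.
Qed.

Lemma degy_gt0 m : (0 < degy m)%N -> exists i, (0 < m (unsplit (inr i)))%N.
Proof.
by rewrite lt0n sum_nat_eq0 negb_forall => /existsP[i]; rewrite /= -lt0n; exists i.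
Qed.

Definition xy_mnm (i : 'I_r.+1) (j : 'I_s.+1) :=
  mnm1 (unsplit (inl i : 'I_r.+1 + 'I_s.+1)) |+| mnm1 (unsplit (inr j)).

Lemma xy_mnmE i j l : xy_mnm i j l =
  (mnm1 (unsplit (inl i : 'I_r.+1 + 'I_s.+1)) l + mnm1 (unsplit (inr j)) l)%N.
Proof. exact: mnmDE. Qed.

Lemma degx_xy_mnm i j : degx (xy_mnm i j) = 1%N.
Proof. by rewrite degxD !degx_mnm1. Qed.

Lemma degy_xy_mnm i j : degy (xy_mnm i j) = 1%N.
Proof. by rewrite degyD !degy_mnm1. Qed.

Lemma mindeg_xy_mnmD i j m : mindeg (xy_mnm i j |+| m) = (mindeg m).+1.
Proof. by rewrite /mindeg degxD degyD degx_xy_mnm degy_xy_mnm -minnSS. Qed.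

Lemma bidiff_xy_mnm i j : bidiff (xy_mnm i j) = 0.
Proof. by rewrite /bidiff degx_xy_mnm degy_xy_mnm. Qed.

Lemma bidiff_xy_mnmD i j m : bidiff (xy_mnm i j |+| m) = bidiff m.
Proof. by rewrite bidiffD bidiff_xy_mnm add0r. Qed.

Lemma mindegS m n : mindeg m = n.+1 -> exists i j m', m = xy_mnm i j |+| m'.
Proof.
move=> mn.
have [i mi] : exists i, (0 < m (unsplit (inl i)))%N.
  by apply: degx_gt0; rewrite /mindeg in mn; lia.
have [j mj] : exists j, (0 < m (unsplit (inr j)))%N.
  by apply: degy_gt0; rewrite /mindeg in mn; lia.
exists i, j, (m |-| xy_mnm i j); rewrite addmC submK //.
apply/mnm_lepP => l; rewrite -(splitK l) mnmDE !mnm1E !unsplit_eq.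
case: (fintype.split l) => l'; rewrite ?addn0 /=.
  by case: eqP => // -[<-].
by case: eqP => // -[<-].
Qed.
End Bidegree.

(** * Polynomials supported on a set of monomials *)

Section Support.
Variables (k : fieldType) (n : nat).
Implicit Types (f g : mpoly n k) (m : multinom n) (P : set (multinom n)).

Definition supported P f := forall m, mcoeff m f != 0 -> P m.

Lemma supported0 P : supported P 0.
Proof. by move=> m; rewrite raddf0 eqxx. Qed.

Lemma supportedD P f g : supported P f -> supported P g -> supported P (f + g).
Proof.
move=> Pf Pg m; have [f0|/Pf//] := eqVneq (mcoeff m f) 0.
by rewrite raddfD /= f0 add0r => /Pg.
Qed.

Lemma supportedM P P' Q f g : (forall m m', P m -> P' m' -> Q (m |+| m')) ->
  supported P f -> supported P' g -> supported Q (f * g).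
Proof.
move=> PQ Pf Pg m; rewrite -mcoeff_msupp => /msuppM_le /allpairsP[[m1 m2] /=].
by rewrite !mcoeff_msupp => -[/Pf ? /Pg ? ->]; exact: PQ.
Qed.

Lemma supportedZ P c f : supported P f -> supported P (c *: f).
Proof. by move=> Pf m; rewrite mcoeffZ mulf_eq0 negb_or => /andP[_ /Pf]. Qed.

Lemma supportedX P m : P m -> supported P (mpolyX k m).
Proof. by move=> Pm m'; rewrite mcoeffX; have [<-//|_] := eqVneq m m'; rewrite eqxx. Qed.

Lemma supported_sum P (J : eqType) (l : seq J) (F : J -> mpoly n k) :
  (forall j, j \in l -> supported P (F j)) -> supported P (\sum_(j <- l) F j).
Proof.
move=> PF; rewrite big_seq; apply: big_ind => //; first exact: supported0.
by move=> f g; exact: supportedD.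
Qed.

Lemma supported_ind P (Q : mpoly n k -> Prop) : Q 0 ->
  (forall f g, Q f -> Q g -> Q (f + g)) ->
  (forall c m, P m -> Q (c *: mpolyX k m)) ->
  forall f, supported P f -> Q f.
Proof.
move=> Q0 QD QX f Pf; rewrite (mpolyE f) big_seq; apply: big_ind => //.
by move=> m; rewrite mcoeff_msupp => /Pf /QX.
Qed.
End Support.

(** * The Segre product as a graded part of the polynomial ring, and its irrelevant ideal *)

Section SegreRing.
Variables (k : fieldType) (r s : nat).
Local Notation n := (r.+1 + s.+1)%N.
Implicit Types (f : mpoly n k) (m : multinom n).

Definition bidiff_eq c : set (multinom n) := [set m | bidiff m = c].

Lemma xy_varM i j : xy_var k (inl i : 'I_r.+1 + 'I_s.+1) * xy_var k (inr j) =
  mpolyX k (xy_mnm i j).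
Proof. by rewrite /xy_mnm mpolyXD. Qed.

(** Polynomials with this support form a subalgebra containing the generators. Conversely, a
    monomial of equal degrees in x and y is a product of factors [x_i y_j], by induction on
    [mindeg]. *)
Lemma segre_subalg_supported f :
  (f : xy_ring k r s) \in subalg_pred (segre_gens (k := k) (r := r) (s := s)) <->
  supported (bidiff_eq 0) f.
Proof.
have [S1 SL SM] := subalg_gen_closed (segre_gens (k := k) (r := r) (s := s)).
have S0 : (0 : xy_ring k r s) \in subalg_pred (segre_gens (k := k) (r := r) (s := s)).
  exact: rpred0.
split=> [/subalg_predP|].
  move=> /(_ (fun f => `[< supported (bidiff_eq 0) f >])) Sf; apply/asboolP/Sf.
    split.
    - apply/asboolP; rewrite -[1]mpolyX0; apply: supportedX.
      by rewrite /bidiff_eq /= /bidiff degx0 degy0.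
    - move=> c g h /asboolP Sg /asboolP Sh; apply/asboolP.
      by apply: supportedD => //; exact: supportedZ.
    - move=> g h /asboolP Sg /asboolP Sh; apply/asboolP.
      apply: supportedM Sg Sh => m m'; rewrite /bidiff_eq /= bidiffD => -> ->.
      by rewrite addr0.
  move=> _ [i [j ->]]; apply/asboolP; rewrite xy_varM; apply: supportedX.
  exact: bidiff_xy_mnm.
move: f; apply: supported_ind => //.
- by move=> f g Sf Sg; rewrite -[f]scale1r; exact: SL.
move=> c m m0; rewrite -[_ *: _]addr0; apply: SL => //.
have [d] := ubnP (mindeg m); elim: d m m0 => // d IHd m m0 md.
have [mind|] := posnP (mindeg m).
  suff -> : m = mnm0 by rewrite mpolyX0.
  by apply/eqP; rewrite -mdeg_eq0 mindeg0_mdeg // m0.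
case mindE : (mindeg m) => [//|e] _; have [i [j [m' mE]]] := mindegS mindE.
rewrite mE mpolyXD -xy_varM; apply: SM.
  by apply/subalg_predP => B _; apply; exists i, j.
move: m0 md; rewrite mE /bidiff_eq /= bidiffD bidiff_xy_mnm add0r mindeg_xy_mnmD.
by move=> m'0 m'd; apply: IHd.
Qed.

Lemma segre_supported (a : segre k r s) :
  supported (bidiff_eq 0) (segre_val a : mpoly n k).
Proof. by apply/segre_subalg_supported; case: a. Qed.

Definition segre_poly f (Sf : supported (bidiff_eq 0) f) : segre k r s :=
  @Segre k r s f (proj2 (segre_subalg_supported f) Sf).

Lemma segre_valD (a b : segre k r s) :
  (segre_val (a + b) : mpoly n k) = (segre_val a : mpoly n k) + segre_val b.
Proof. exact: (raddfD (val : segre k r s -> xy_ring k r s)). Qed.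

Lemma segre_valM (a b : segre k r s) :
  (segre_val (a * b) : mpoly n k) = (segre_val a : mpoly n k) * segre_val b.
Proof. exact: (rmorphM (val : segre k r s -> xy_ring k r s)). Qed.

Definition segre_eps (a : segre k r s) : k :=
  mcoeff mnm0 (segre_val a : mpoly n k).

Lemma segre_eps_is_additive : additive segre_eps.
Proof.
move=> a b; rewrite /segre_eps.
have -> : (segre_val (a - b) : mpoly n k) = (segre_val a : mpoly n k) - segre_val b.
  exact: (raddfB (val : segre k r s -> xy_ring k r s)).
by rewrite mcoeffB.
Qed.

Lemma segre_eps_is_multiplicative : multiplicative segre_eps.
Proof.
have [eM e1] := mcoeff0_is_multiplicative n k.
split=> [a b|]; first by rewrite /segre_eps segre_valM eM.
by rewrite /segre_eps; exact: e1.
Qed.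

HB.instance Definition _ :=
  GRing.isAdditive.Build (segre k r s) k segre_eps segre_eps_is_additive.
HB.instance Definition _ :=
  GRing.isMultiplicative.Build (segre k r s) k segre_eps segre_eps_is_multiplicative.

Definition min_ge d : set (multinom n) := [set m | (d <= mindeg m)%N].

Lemma mindegD m m' : (mindeg m + mindeg m' <= mindeg (m |+| m'))%N.
Proof. by rewrite /mindeg degxD degyD; lia. Qed.

Lemma min_geM d d' f g : supported (min_ge d) f -> supported (min_ge d') g ->
  supported (min_ge (d + d')) (f * g).
Proof.
apply: supportedM => m m' dm dm'.
by apply: leq_trans (mindegD m m'); exact: leq_add.
Qed.

(** A monomial with [bidiff] and [mindeg] both 0 is 1, and its coefficient vanishes by
    assumption. *)
Lemma segre_bidiff_min f : supported (bidiff_eq 0) f -> mcoeff mnm0 f = 0 ->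
  supported (min_ge 1) f.
Proof.
move=> Sf f0 m fm; rewrite /min_ge /= lt0n; apply/eqP => mm.
have := mindeg0_mdeg mm; rewrite (Sf _ fm) => /eqP; rewrite mdeg_eq0 => /eqP m0.
by rewrite m0 f0 eqxx in fm.
Qed.

(** Without its constant term, [a] only has monomials with [mindeg] at least 1, which cannot
    contribute to [m]. So the ring acts on these coefficients through its residue field. *)
Lemma mcoeff_segreM (a : segre k r s) f m : mindeg m = 0%N ->
  mcoeff m ((segre_val a : mpoly n k) * f) = segre_eps a * mcoeff m f.
Proof.
move=> m0; pose c := segre_eps a *: mpolyX k (mnm0 : multinom n).
have -> : (segre_val a : mpoly n k) = c + ((segre_val a : mpoly n k) - c).
  by rewrite addrC subrK.
rewrite mulrDl mcoeffD /c mpolyX0 -scalerAl mul1r mcoeffZ -[RHS]addr0.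
congr (_ + _); apply/eqP; apply: contraT => nz.
suff /(_ _ nz) : supported (min_ge (1 + 0))
    (((segre_val a : mpoly n k) - segre_eps a *: 1) * f).
  by rewrite /min_ge /= m0.
apply: min_geM => //; apply: segre_bidiff_min.
  apply: supportedD; first exact: segre_supported.
  rewrite -scaleNr; apply: supportedZ; rewrite -mpolyX0; apply: supportedX.
  by rewrite /bidiff_eq /= /bidiff degx0 degy0.
by rewrite mcoeffB mcoeffZ mcoeff1 eqxx mulr1 subrr.
Qed.

Definition segre_mon i j : segre k r s :=
  segre_poly (supportedX (P := bidiff_eq 0) (bidiff_xy_mnm i j)).

Lemma segre_eps_mon i j : segre_eps (segre_mon i j) = 0.
Proof.
rewrite /segre_eps /= mcoeffX; case: eqP => // /(congr1 (@degx r s)).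
by rewrite degx0 degx_xy_mnm.
Qed.

(** Finite generation of the irrelevant ideal, which the passage from completions to quotients
    requires. *)
Lemma irrelevant_gen (a : segre k r s) : segre_eps a = 0 ->
  exists h : 'I_r.+1 * 'I_s.+1 -> segre k r s,
    a = \sum_p h p * segre_mon p.1 p.2.
Proof.
move=> a0.
suff [h ah] : exists h : 'I_r.+1 * 'I_s.+1 -> segre k r s,
    (segre_val a : mpoly n k) = segre_val (\sum_p h p * segre_mon p.1 p.2).
  by exists h; exact: val_inj.
have Sa : supported (bidiff_eq 0 `&` min_ge 1) (segre_val a : mpoly n k).
  move=> m am; split; first exact: segre_supported am.
  exact: (segre_bidiff_min (@segre_supported a) a0 am).
move: (segre_val a : mpoly n k) Sa; apply: supported_ind.
- exists (fun=> 0); rewrite big1 => [|p _]; last by rewrite mul0r.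
  by [].
- move=> f g [h ->] [h' ->]; exists (fun p => h p + h' p).
  rewrite -segre_valD -big_split; congr segre_val.
  by apply: eq_bigr => p _; rewrite mulrDl.
- move=> c m [m0 m1].
  have [i [j [m' mE]]] : exists i j m', m = xy_mnm i j |+| m'.
    exact: mindegS (esym (prednK m1)).
  have Sm' : supported (bidiff_eq 0) (c *: mpolyX k m').
    apply: supportedZ; apply: supportedX; move: m0.
    by rewrite mE /bidiff_eq /= bidiffD bidiff_xy_mnm add0r.
  exists (fun p => if p == (i, j) then segre_poly Sm' else 0).
  transitivity (segre_val (segre_poly Sm' * segre_mon i j) : mpoly n k).
    by rewrite segre_valM mE addmC mpolyXD scalerAl.
  congr segre_val; rewrite (bigD1 (i, j)) //= eqxx big1 ?addr0 //.
  by move=> p /negPf ->; rewrite mul0r.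
Qed.
End SegreRing.

(** * Divisorial ideals *)

Section Sigma.
Variables (r s : nat) (V : zmodType).
Implicit Types (m : Defs.point r s V) (b : 'I_r.+1 + 'I_s.+1 -> V).

Lemma chain_sum n (x0 : V) (x : 'I_n -> V) :
  \sum_(j < n.+1) (chain x0 x j - chain x0 x j.+1) = x0.
Proof.
rewrite -(big_mkord xpredT (fun j => chain x0 x j - chain x0 x j.+1)).
rewrite -[LHS]opprK -sumrN; under eq_bigr do rewrite opprB.
by rewrite telescope_sumr // /chain insubF ?ltnn //= sub0r opprK.
Qed.

Lemma sigma_sum m :
  \sum_i sigma m (inl i) = pt0 m /\ \sum_j sigma m (inr j) = pt0 m.
Proof. by split; exact: chain_sum. Qed.

Lemma chain_tail n (b : 'I_n.+1 -> V) (j : nat) : (j <= n.+1)%N ->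
  chain (\sum_i b i) (fun t : 'I_n => \sum_(i < n.+1 | (t < i)%N) b i) j
  = \sum_(i < n.+1 | (j <= i)%N) b i.
Proof.
case: j => [|j] jn; first by [].
rewrite /chain; case: insubP => [t _ tj|] /=; first by rewrite tj.
rewrite -leqNgt => nj; rewrite big_pred0 // => i.
by have := ltn_ord i; lia.
Qed.

Lemma chain_tailB n (b : 'I_n.+1 -> V) (j : 'I_n.+1) :
  chain (\sum_i b i) (fun t : 'I_n => \sum_(i < n.+1 | (t < i)%N) b i) j -
  chain (\sum_i b i) (fun t : 'I_n => \sum_(i < n.+1 | (t < i)%N) b i) j.+1 = b j.
Proof.
rewrite !chain_tail //; last exact: ltnW.
rewrite (bigD1 j) //= (eq_bigl (fun i : 'I__ => (j < i)%N)) ?addrK // => i.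
by rewrite ltn_neqAle eq_sym andbC.
Qed.

(** The only relation between the forms is that both families sum to [X_0]; the other coordinates
    are recovered as tail sums of the prescribed values. *)
Lemma sigma_surj b : \sum_i b (inl i) = \sum_j b (inr j) ->
  exists m, forall v, sigma m v = b v.
Proof.
move=> bE; exists (Point (\sum_i b (inl i))
  (fun t => \sum_(i < r.+1 | (t < i)%N) b (inl i))
  (fun t => \sum_(j < s.+1 | (t < j)%N) b (inr j))).
case=> [i|j] /=; first exact: (chain_tailB (fun i => b (inl i))).
by rewrite bE; exact: (chain_tailB (fun j => b (inr j))).
Qed.
End Sigma.

Section Divisorial.
Variables (k : fieldType) (r s : nat).
Local Notation n := (r.+1 + s.+1)%N.
Implicit Types (f : mpoly n k) (m : multinom n) (a : divisor r s).

(** The image of [a] in the class group, identified with the integers so that [class_divisor c] goes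
    to [c]. *)
Definition divisor_class a : int := \sum_i a (inl i) - \sum_j a (inr j).

(** A Laurent monomial whose degrees in x and y may differ; dividing by it moves [T(a)] into the
    polynomial ring. *)
Definition theta a : xy_frac k r s := \prod_v tofrac (xy_var k v) ^ a v.

Lemma tofrac_var_neq0 (v : 'I_r.+1 + 'I_s.+1) :
  tofrac (xy_var k v) != 0 :> xy_frac k r s.
Proof.
rewrite tofrac_eq0; apply/eqP => /mpolyP /(_ (mnm1 (unsplit v))).
rewrite mcoeffX eqxx mcoeff0 => /eqP; by rewrite oner_eq0.
Qed.

Lemma theta_neq0 a : theta a != 0.
Proof. by apply/prodf_neq0 => v _; rewrite expfz_neq0 // tofrac_var_neq0. Qed.

Lemma theta_mpolyX a m :
  theta a * tofrac (mpolyX k m : xy_ring k r s) =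
  \prod_v tofrac (xy_var k v) ^ (a v + (m (unsplit v))%:Z).
Proof.
have -> : tofrac (mpolyX k m : xy_ring k r s) =
    \prod_v tofrac (xy_var k v) ^ (m (unsplit v))%:Z :> xy_frac k r s.
  rewrite mpolyXE_id rmorph_prod.
  rewrite (reindex_onto (@unsplit r.+1 s.+1) (@fintype.split _ _)) /=; last first.
    by move=> v _; exact: splitK.
  apply: eq_big => [v|v _]; first by rewrite unsplitK eqxx.
  by rewrite rmorphXn.
rewrite -big_split; apply: eq_bigr => v _ /=.
by rewrite expfzDr // tofrac_var_neq0.
Qed.

Lemma divisorial_gen_supported a z : divisorial_gens (k := k) a z ->
  exists2 m, bidiff_eq (divisor_class a) m
    & z = theta a * tofrac (mpolyX k m : xy_ring k r s).
Proof.
move=> [p ap <-].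
(* The inequalities defining the generators make these differences nonnegative, so [absz] loses
   nothing. *)
pose m : multinom n := Multinom
  [tuple absz (sigma p (fintype.split i) - a (fintype.split i)) | i < n].
have mE v : (m (unsplit v))%:Z = sigma p v - a v.
  rewrite multinomE tnth_mktuple unsplitK gez0_abs // subr_ge0.
  exact: ap.
have [sx sy] := sigma_sum p.
exists m.
  have xE : (degx m)%:Z = pt0 p - \sum_i a (inl i).
    by rewrite -sx -sumrB (big_morph Posz PoszD (erefl _)); apply: eq_bigr.
  have yE : (degy m)%:Z = pt0 p - \sum_j a (inr j).
    by rewrite -sy -sumrB (big_morph Posz PoszD (erefl _)); apply: eq_bigr.
  by rewrite /bidiff_eq /= /bidiff xE yE /divisor_class; lia.
rewrite theta_mpolyX; apply: eq_bigr => v _.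
by rewrite mE addrC subrK.
Qed.

Lemma supported_divisorial_gen a m : bidiff_eq (divisor_class a) m ->
  divisorial_gens a (theta a * tofrac (mpolyX k m : xy_ring k r s)).
Proof.
move=> ma; pose b v := a v + (m (unsplit v))%:Z.
have [|p pb] := sigma_surj (b := b).
  have -> : \sum_i b (inl i) = \sum_i a (inl i) + (degx m)%:Z.
    by rewrite /degx (big_morph Posz PoszD (erefl _)) -big_split.
  have -> : \sum_j b (inr j) = \sum_j a (inr j) + (degy m)%:Z.
    by rewrite /degy (big_morph Posz PoszD (erefl _)) -big_split.
  move: ma; rewrite /bidiff_eq /= /divisor_class => /eqP.
  by rewrite eq_sym subr_eq => /eqP ->; rewrite /bidiff addrAC subrK addrC.
exists p; first by move=> v; rewrite pb lerDl.
by rewrite theta_mpolyX; apply: eq_bigr => v _; rewrite pb.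
Qed.

(** After division by [theta a], the inequalities on the forms [sigma] become nonnegativity of the
    exponents, and the equality of the two sums of the [sigma] fixes the value of [bidiff]. *)
Lemma divisorialP a (z : xy_frac k r s) :
  z \in submod_pred (divisorial_gens a) <->
  exists2 f, supported (bidiff_eq (divisor_class a)) f
    & z = theta a * tofrac (f : xy_ring k r s).
Proof.
have scaleE (c : segre k r s) (w : xy_frac k r s) :
  c *: w = tofrac (segre_val c) * w by [].
split.
  move=> /submod_predP /(_ (fun w => `[< exists2 f,
    supported (bidiff_eq (divisor_class a)) f
    & w = theta a * tofrac (f : xy_ring k r s) >])) Bz; apply/asboolP/Bz.
    split; first by apply/asboolP; exists 0; [exact: supported0 | rewrite rmorph0 mulr0].
    move=> c u v /asboolP[f Sf ->] /asboolP[g Sg ->]; apply/asboolP.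
    exists ((segre_val c : mpoly n k) * f + g).
      apply: supportedD => //; apply: supportedM (@segre_supported _ _ _ c) Sf.
      by move=> m m' m0 m'0; rewrite /bidiff_eq /= bidiffD m0 m'0 add0r.
    by rewrite scaleE rmorphD rmorphM mulrDr mulrCA.
  move=> g /divisorial_gen_supported[m ma ->]; apply/asboolP.
  by exists (mpolyX k m) => //; exact: supportedX.
have [S0 SL] := submod_gen_closed (@divisorial_gens k r s a).
move=> [f Sf ->]; move: f Sf; apply: supported_ind.
- by rewrite rmorph0 mulr0.
- by move=> f g Sf Sg; rewrite rmorphD mulrDr -[theta a * _]scale1r; exact: SL.
move=> c m ma.
(* Scalars of [k] act as constants of the Segre product. *)
have Sc : supported (bidiff_eq 0) (c *: mpolyX k (mnm0 : multinom n)).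
  apply: supportedZ; apply: supportedX.
  by rewrite /bidiff_eq /= /bidiff degx0 degy0.
have -> : theta a * tofrac (c *: mpolyX k m : xy_ring k r s) =
    segre_poly Sc *: (theta a * tofrac (mpolyX k m : xy_ring k r s)) + 0.
  rewrite addr0 scaleE mulrCA -rmorphM /=; congr (_ * tofrac _).
  by rewrite -scalerAl mpolyX0 mul1r.
apply: SL => //.
by apply/submod_predP => B _; apply; exact: supported_divisorial_gen.
Qed.
End Divisorial.

(** * Divisorial ideals as spaces of polynomials, and their filtration *)

Section Numerators.
Variables (k : fieldType) (r s : nat) (a : divisor r s).
Local Notation n := (r.+1 + s.+1)%N.
Local Notation T := (divisorial k a).
Local Notation I := [set c : segre k r s | segre_eps c = 0].
Implicit Types (f : mpoly n k) (m : multinom n) (z w : T).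

Lemma numerator_exists z : exists f, supported (bidiff_eq (divisor_class a)) f /\
  (divisorial_val z : xy_frac k r s) = theta k a * tofrac (f : xy_ring k r s).
Proof.
have [f Sf zf] : exists2 f, supported (bidiff_eq (divisor_class a)) f
    & (divisorial_val z : xy_frac k r s) = theta k a * tofrac (f : xy_ring k r s).
  by apply/divisorialP; case: z.
by exists f.
Qed.

Definition numerator z : mpoly n k := sval (cid (numerator_exists z)).

Lemma numerator_supported z :
  supported (bidiff_eq (divisor_class a)) (numerator z).
Proof. by rewrite /numerator; case: cid => f []. Qed.

Lemma divisorial_valE z : (divisorial_val z : xy_frac k r s) =
  theta k a * tofrac (numerator z : xy_ring k r s).
Proof. by rewrite /numerator; case: cid => f []. Qed.

Lemma numerator_unique z f :
  (divisorial_val z : xy_frac k r s) = theta k a * tofrac (f : xy_ring k r s) ->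
  numerator z = f.
Proof.
by rewrite divisorial_valE => /(mulfI (theta_neq0 k a)) /eqP; rewrite tofrac_eq => /eqP.
Qed.

Lemma numerator_inj z w : numerator z = numerator w -> z = w.
Proof. by move=> zw; apply: val_inj; rewrite /= !divisorial_valE zw. Qed.

Lemma numeratorP (c : segre k r s) z w :
  numerator (c *: z + w) = (segre_val c : mpoly n k) * numerator z + numerator w.
Proof.
apply: numerator_unique; rewrite rmorphD rmorphM mulrDr mulrCA -!divisorial_valE.
by [].
Qed.

Lemma numeratorD z w : numerator (z + w) = numerator z + numerator w.
Proof. by rewrite -[z]scale1r numeratorP scale1r; congr (_ + _); exact: mul1r. Qed.

Lemma numerator0 : numerator 0 = 0.
Proof. by apply: (addIr (numerator 0)); rewrite -numeratorD addr0 add0r. Qed.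

Lemma numeratorZ (c : segre k r s) z :
  numerator (c *: z) = (segre_val c : mpoly n k) * numerator z.
Proof. by rewrite -[c *: z]addr0 numeratorP numerator0 addr0. Qed.

Lemma numeratorB z w : numerator (z - w) = numerator z - numerator w.
Proof.
by apply: (addIr (numerator w)); rewrite -numeratorD !subrK.
Qed.

Lemma numerator_sum (J : finType) (F : J -> T) :
  numerator (\sum_j F j) = \sum_j numerator (F j).
Proof. exact: (big_morph _ numeratorD numerator0). Qed.

Definition of_numerator f (Sf : supported (bidiff_eq (divisor_class a)) f) : T :=
  Divisorial (proj2 (divisorialP a (theta k a * tofrac (f : xy_ring k r s)))
    (ex_intro2 _ _ f Sf erefl)).

Lemma of_numeratorK f (Sf : supported (bidiff_eq (divisor_class a)) f) :
  numerator (of_numerator Sf) = f.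
Proof. exact: numerator_unique. Qed.

(** Multiplication by an element of the ideal raises [mindeg]. Conversely, a monomial with [mindeg]
    at least [d + 1] has a factor [x_i y_j], and induction applies to the cofactor. *)
Lemma adic_numerator d z :
  adic I d z <-> supported (min_ge (r := r) (s := s) d) (numerator z).
Proof.
split.
  elim: d z => [//|d IHd]; apply: adic_ind.
  - by rewrite numerator0; exact: supported0.
  - move=> c u v Su Sv; rewrite numeratorP; apply: supportedD => //.
    by apply: (min_geM (d := 0) (d' := d.+1)) Su.
  - move=> c u c0 /IHd Su; rewrite numeratorZ; apply: (min_geM (d := 1) (d' := d)) Su.
    exact: segre_bidiff_min (@segre_supported _ _ _ c) c0.
move=> Sz; suff [w wz dw] : exists2 w, numerator w = numerator z & adic I d w.
  by rewrite -(numerator_inj wz).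
have {Sz}: supported (bidiff_eq (divisor_class a) `&` min_ge d) (numerator z).
  by move=> m zm; split; [exact: numerator_supported zm | exact: Sz zm].
elim: d (numerator z) => [|d IHd].
  move=> f Sf.
  have Sf' : supported (bidiff_eq (divisor_class a)) f by move=> m /Sf[].
  by exists (of_numerator Sf'); rewrite ?of_numeratorK.
apply: supported_ind.
- by exists 0; [exact: numerator0 | exact: adic0].
- move=> f g [u <- du] [v <- dv]; exists (u + v); first exact: numeratorD.
  exact: adicD.
move=> c m [ma dm].
have [i [j [m' mE]]] := mindegS (esym (prednK (leq_ltn_trans (leq0n d) dm))).
have [|w wE dw] := IHd (c *: mpolyX k m').
  apply: supportedZ; apply: supportedX; split.
    by move: ma; rewrite mE /bidiff_eq /= bidiffD bidiff_xy_mnm add0r.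
  by move: dm; rewrite mE /min_ge /= mindeg_xy_mnmD.
exists (segre_mon k i j *: w).
  rewrite numeratorZ wE mE mpolyXD -scalerAr.
  by [].
by apply: adic_genM => //; exact: segre_eps_mon.
Qed.
End Numerators.

(** * Division chains and minimal generators of a divisorial ideal *)

Section DivisorialRank.
Variables (k : fieldType) (r s : nat) (a : divisor r s).
Local Notation n := (r.+1 + s.+1)%N.
Local Notation T := (divisorial k a).
Local Notation I := [set c : segre k r s | segre_eps c = 0].
Implicit Types (f : mpoly n k) (m : multinom n) (z w : T).

Variables (i i' : 'I_r.+1) (j j' : 'I_s.+1) (l : 'I_n).
Hypothesis gl : xy_mnm i j l = 0%N.
Hypothesis hl : xy_mnm i' j' l = 1%N.
Hypothesis hgl : forall m, (0 < m l)%N -> lem (xy_mnm i' j') (xy_mnm i j |+| m).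
Local Notation g := (segre_mon k i j).
Local Notation h := (segre_mon k i' j').

Lemma numerator_mon (i0 : 'I_r.+1) (j0 : 'I_s.+1) z :
  numerator (segre_mon k i0 j0 *: z) = mpolyX k (xy_mnm i0 j0) * numerator z.
Proof. by rewrite numeratorZ. Qed.

(** Each step of the chain multiplies monomials by [g/h], which lowers the exponent of [l] by one.
    Only monomials with [mindeg] 0 matter: their products with [g] have [mindeg] 1 and are visible
    modulo [I^2], while the others are sent into [I^2]. *)
Lemma quot_chain_divisorial d z : quot_chain (@segre_eps k r s) g h d z <->
  forall m, mcoeff m (numerator z) != 0 -> mindeg m = 0%N -> (d <= m l)%N.
Proof.
elim: d z => [|d IHd] z; first by split.
split.
  move=> [w /IHd wd /adic_numerator]; rewrite numeratorB !numerator_mon => S2 m zm m0.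
  (* This monomial has [mindeg] 1, so it survives modulo [I^2] and must occur in [h] times the
     numerator of [w]. *)
  have : mcoeff (xy_mnm i j |+| m) (mpolyX k (xy_mnm i' j') * numerator w) != 0.
    apply: contraNneq zm => wm.
    have [//|/S2] := eqVneq (mcoeff (xy_mnm i j |+| m) (mpolyX k (xy_mnm i j) *
      numerator z - mpolyX k (xy_mnm i' j') * numerator w)) 0.
      by rewrite mcoeffB wm subr0 mulrC mcoeffMX => ->.
    by rewrite /min_ge /= mindeg_xy_mnmD m0.
  rewrite -mcoeff_msupp => /msuppM_le /allpairsP[[m1 m2] /= [m1h wm2 mE]].
  move: m1h; rewrite mcoeff_msupp mcoeffX.
  have [m1E _|_] := eqVneq (xy_mnm i' j') m1; last by rewrite eqxx.
  rewrite mcoeff_msupp in wm2; rewrite -m1E in mE.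
  have m20 : mindeg m2 = 0%N.
    by have := congr1 (@mindeg r s) mE; rewrite !mindeg_xy_mnmD m0 => -[].
  move: mE => /(congr1 (fun m => m l)); rewrite (mnmDE l (xy_mnm i j)).
  rewrite (mnmDE l (xy_mnm i' j')) gl hl add0n => ->.
  by rewrite add1n ltnS; exact: wd.
move=> zd.
pose low := [seq m <- msupp (numerator z) | mindeg m == 0%N].
have lowP m : m \in low -> [/\ mcoeff m (numerator z) != 0, mindeg m = 0%N & (d < m l)%N].
  rewrite mem_filter mcoeff_msupp => /andP[/eqP m0 zm]; split=> //; exact: zd.
pose mv m := (xy_mnm i j |+| m) |-| xy_mnm i' j'.
have mvE m : m \in low -> xy_mnm i' j' |+| mv m = xy_mnm i j |+| m.
  by move=> /lowP[_ _ dm]; rewrite addmC submK //; apply: hgl; exact: leq_ltn_trans dm.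
(* The part of the numerator with [mindeg] 0, multiplied by [g/h]; the division is exact by
   [hgl]. *)
pose f := \sum_(m <- low) mcoeff m (numerator z) *: mpolyX k (mv m).
have Sf P : (forall m, m \in low -> P (mv m)) -> supported P f.
  move=> Pmv; apply: supported_sum => m mlow; apply: supportedZ; apply: supportedX.
  exact: Pmv.
have Sf0 : supported (bidiff_eq (divisor_class a)) f.
  apply: Sf => m mlow; have [/numerator_supported ma _ _] := lowP m mlow.
  have := congr1 (@bidiff r s) (mvE m mlow); rewrite !bidiff_xy_mnmD.
  by rewrite /bidiff_eq /= => ->.
exists (of_numerator Sf0).
  apply/IHd => m; rewrite of_numeratorK.
  move=> fm _; move: m fm; apply: Sf => m mlow; have [_ _ dm] := lowP m mlow.
  move: (mvE m mlow) dm => /(congr1 (fun m => m l)).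
  rewrite (mnmDE l (xy_mnm i j)) (mnmDE l (xy_mnm i' j')) gl hl add0n => <-.
  by [].
apply/adic_numerator; rewrite numeratorB !numerator_mon of_numeratorK.
have -> : mpolyX k (xy_mnm i' j') * f = mpolyX k (xy_mnm i j) *
    \sum_(m <- low) mcoeff m (numerator z) *: mpolyX k m.
  rewrite !mulr_sumr big_seq [RHS]big_seq; apply: eq_bigr => m mlow.
  by rewrite -!scalerAr -!mpolyXD mvE.
(* The factor [g] contributes 1 to [mindeg], and the monomials outside [low] contribute at least
   1. *)
rewrite -mulrBr; apply: (min_geM (d := 1) (d' := 1)).
  by apply: supportedX; rewrite /min_ge /= /mindeg degx_xy_mnm degy_xy_mnm.
rewrite [X in supported _ (X - _)](mpolyE (numerator z)) /low big_filter.
rewrite (bigID (fun m => mindeg m == 0%N)) /= addrAC subrr add0r -big_filter.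
apply: supported_sum => m; rewrite mem_filter -lt0n => /andP[m0 _].
by apply: supportedZ; exact: supportedX.
Qed.

(** Such monomials have degree [|c|] by [mindeg0_mdeg], so bounded multinomials capture all of them
    in a finite type. *)
Definition low_mnm (l0 : 'I_n) d (c : int) (m : bmultinom n (absz c).+1) : bool :=
  [&& bidiff m == c, mindeg m == 0%N & (d <= m l0)%N].

(** The monomials themselves form the basis: modulo [I] an element is determined by its coefficients
    at monomials with [mindeg] 0, where scalars act through [segre_eps]. *)
Lemma has_rank_divisorial d :
  has_rank (@segre_eps k r s) (quot_chain (M := T) (@segre_eps k r s) g h d)
    {m : bmultinom n (absz (divisor_class a)).+1 | low_mnm l d m}.
Proof.
pose J : finType :=
  {m : bmultinom n (absz (divisor_class a)).+1 | low_mnm l d m}.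
pose mon (x : J) : multinom n := bmnm (sval x).
have mon_inj : injective mon by move=> x y xy; do 2!apply: val_inj.
have monP (x : J) :
    [/\ bidiff (mon x) = divisor_class a, mindeg (mon x) = 0%N & (d <= mon x l)%N].
  by case: x => m mJ; have /and3P[/eqP ? /eqP ? ?] := mJ.
have Sj (x : J) : supported (bidiff_eq (divisor_class a)) (mpolyX k (mon x)).
  by apply: supportedX; case: (monP x).
pose e x := of_numerator (Sj x).
have coefE (b : J -> segre k r s) m : mindeg m = 0%N ->
    mcoeff m (numerator (\sum_x b x *: e x)) =
    \sum_(x | mon x == m) segre_eps (b x).
  move=> m0; rewrite numerator_sum raddf_sum /= [RHS]big_mkcond.
  apply: eq_bigr => x _; rewrite numeratorZ mcoeff_segreM // of_numeratorK mcoeffX.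
  by case: eqP => _; rewrite ?mulr1 ?mulr0.
exists e; split.
- move=> x; apply/quot_chain_divisorial => m; rewrite of_numeratorK mcoeffX.
  have [<- _ _|_] := eqVneq (mon x) m; last by rewrite eqxx.
  by case: (monP x).
- move=> z /quot_chain_divisorial zd.
  have Sc c : supported (bidiff_eq (r := r) (s := s) 0) (c *: mpolyX k (mnm0 : multinom n)).
    apply: supportedZ; apply: supportedX.
    by rewrite /bidiff_eq /= /bidiff degx0 degy0.
  exists (fun x => segre_poly (Sc (mcoeff (mon x) (numerator z)))).
  apply/adic_numerator => m; rewrite numeratorB mcoeffB /min_ge /= lt0n.
  apply: contra => /eqP m0; rewrite coefE // subr_eq0.
  have epsE c : segre_eps (segre_poly (Sc c)) = c.
    by rewrite /segre_eps /= mcoeffZ mcoeffX eqxx mulr1.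
  under eq_bigr do rewrite epsE.
  have [zm|zm] := eqVneq (mcoeff m (numerator z)) 0.
    by rewrite zm eq_sym; apply/eqP/big1 => x /eqP ->.
  have md : (mdeg m < (absz (divisor_class a)).+1)%N.
    by rewrite (mindeg0_mdeg m0) (numerator_supported zm).
  have mJ : low_mnm l d (BMultinom md).
    by rewrite /low_mnm /= (numerator_supported zm) m0 !eqxx zd.
  pose x : J := exist (fun b : bmultinom n (absz (divisor_class a)).+1 =>
    low_mnm l d b) _ mJ.
  rewrite (big_pred1 x) => [|y]; first exact: eqxx.
  by rewrite -[RHS]/(y == x); apply/eqP/eqP => [ym|->//]; exact: mon_inj.
- move=> b /adic_numerator Sb x; have [_ x0 _] := monP x.
  have [|/Sb] := eqVneq (mcoeff (mon x) (numerator (\sum_x b x *: e x))) 0.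
    rewrite coefE // (big_pred1 x) => [//|y].
    by rewrite -[RHS]/(y == x); apply/eqP/eqP => [/mon_inj//|->].
  by rewrite /min_ge /= x0.
Qed.
End DivisorialRank.

(** * Uniqueness of the multiplicities *)

(** Descending induction on [|j|]: in the equation for [j], classes [c] other than [j] with
    [|c| <= |j|] contribute nothing, and for [|c| > |j|] the multiplicities already agree. *)
Lemma triangular_count (rho : int -> int -> nat) (cs cs' : seq int) :
  (forall j, rho j j = 1%N) ->
  (forall j c, c != j -> (absz c <= absz j)%N -> rho j c = 0%N) ->
  (forall j, \sum_(c <- cs) rho j c = \sum_(c <- cs') rho j c)%N ->
  forall j, count_mem j cs = count_mem j cs'.
Proof.
move=> rho1 rho0 rhoE.
pose l := undup (cs ++ cs').
have sumE (ds : seq int) j : {subset ds <= l} ->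
    (\sum_(c <- ds) rho j c = \sum_(i <- l) count_mem i ds * rho j i)%N.
  elim: ds => [_|d ds IHds dsl].
    by rewrite big_nil big1.
  rewrite big_cons IHds => [|x xds]; last by rewrite dsl // inE xds orbT.
  under [RHS]eq_bigr do rewrite /= mulnDl.
  rewrite big_split; congr (_ + _)%N.
  rewrite (bigD1_seq d) ?undup_uniq ?dsl ?mem_head //= eqxx mul1n.
  by rewrite big1 ?addn0 // => i; rewrite eq_sym => /negPf ->.
have csl : {subset cs <= l} by move=> x xcs; rewrite mem_undup mem_cat xcs.
have csl' : {subset cs' <= l} by move=> x xcs; rewrite mem_undup mem_cat xcs orbT.
(* [B] exceeds the absolute value of every class that occurs, so the induction can run on
   [B - absz j]. *)
pose B := (\max_(i <- l) absz i).+1.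
have notin j (ds : seq int) : {subset ds <= l} -> (j \notin l) -> count_mem j ds = 0%N.
  move=> dsl jl; apply/eqP; rewrite -leqn0 leqNgt -has_count has_pred1.
  by apply: contra jl => /dsl.
move=> j; have [d] := ubnP (B - absz j)%N; elim: d j => // d IHd j jd.
have [jl|jl] := boolP (j \in l); last by rewrite !notin.
have := rhoE j; rewrite !sumE // !(bigD1_seq j) ?undup_uniq //=.
rewrite rho1 !muln1 [X in (_ + X)%N = _](_ : _ =
  \sum_(i <- l | i != j) count_mem i cs' * rho j i)%N; first by move/addIn.
rewrite [LHS]big_seq_cond [RHS]big_seq_cond; apply: eq_bigr => i /andP[il ij].
have [ilej|jlti] := leqP (absz i) (absz j); first by rewrite rho0 ?muln0.
have iB : (absz i < B)%N by rewrite ltnS; exact: leq_bigmax_seq.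
by rewrite IHd //; lia.
Qed.

(** * Test ranks of divisorial ideals *)

Section Multiplicities.
Variables (k : fieldType) (r s : nat).
Hypotheses (r_gt0 : (0 < r)%N) (s_gt0 : (0 < s)%N).
Local Notation n := (r.+1 + s.+1)%N.
Local Notation I := [set c : segre k r s | segre_eps c = 0].

Definition test_var (j : int) : 'I_r.+1 + 'I_s.+1 :=
  if 0 <= j then inr ord0 else inl ord0.

(** Its quotient by [x_1 y_1] is [y_{s+1}/y_1] or [x_{r+1}/x_1], in which the two variables differ
    because [r] and [s] are positive. *)
Definition test_elt (j : int) : segre k r s :=
  if 0 <= j then segre_mon k ord0 ord_max else segre_mon k ord_max ord0.

(* The number of monomial generators of a divisorial ideal of class c that are
   divisible by the power |j| of the test variable, y_1 or x_1 according to the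
   sign of j. As these generators have degree |c|, the only one with |c| <= |j|
   is that power itself, when c = j. *)
Definition test_rank (j c : int) : nat :=
  #|{: {m : bmultinom n (absz c).+1 | low_mnm (unsplit (test_var j)) (absz j) m}}|.

Lemma test_rank_divisorial (a : divisor r s) j :
  has_rank (@segre_eps k r s)
    (quot_chain (M := divisorial k a) (@segre_eps k r s)
       (test_elt j) (segre_mon k ord0 ord0) (absz j))
    {m : bmultinom n (absz (divisor_class a)).+1 |
      low_mnm (unsplit (test_var j)) (absz j) m}.
Proof.
rewrite /test_elt /test_var; case: ifP => _; apply: has_rank_divisorial.
- rewrite xy_mnmE !mnm1E !unsplit_eq; apply/eqP; rewrite addn_eq0 !eqb0.
  by apply/andP; split; apply/eqP => // -[]; lia.
- by rewrite xy_mnmE !mnm1E !unsplit_eq eqxx.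
- move=> m m0; apply/mnm_lepP => l; have [<-|ml] := eqVneq (unsplit (inr ord0)) l.
    by rewrite (mnmDE _ _ m) !xy_mnmE !mnm1E !unsplit_eq eqxx; lia.
  by rewrite (mnmDE _ _ m) !xy_mnmE !mnm1E (negPf ml); lia.
- rewrite xy_mnmE !mnm1E !unsplit_eq; apply/eqP; rewrite addn_eq0 !eqb0.
  by apply/andP; split; apply/eqP => // -[]; lia.
- by rewrite xy_mnmE !mnm1E !unsplit_eq eqxx.
- move=> m m0; apply/mnm_lepP => l; have [<-|ml] := eqVneq (unsplit (inl ord0)) l.
    by rewrite (mnmDE _ _ m) !xy_mnmE !mnm1E !unsplit_eq eqxx; lia.
  by rewrite (mnmDE _ _ m) !xy_mnmE !mnm1E (negPf ml); lia.
Qed.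

(** The exponent of the test variable is at most the degree [|c|]; in case of equality the monomial
    is a power of the test variable, so [c] has the sign of [j]. *)
Lemma test_rank_ge (j c : int) (m : bmultinom n (absz c).+1) :
  low_mnm (unsplit (test_var j)) (absz j) m ->
  (absz j <= absz c)%N /\ (absz c = absz j -> c = j).
Proof.
move=> /and3P[/eqP mc /eqP m0 jm].
have md := mindeg0_mdeg m0; rewrite mc in md.
have jc : (absz j <= absz c)%N by rewrite -md; apply: leq_trans jm (mnm_le_mdeg _ _).
split=> // cj; move: jm m0 mc md; rewrite /test_var mdeg_degxy /mindeg /bidiff.
case: ifP => j0.
  have : (m (unsplit (inr ord0)) <= degy m)%N by rewrite /degy (bigD1 ord0) //= leq_addr.
  lia.
have : (m (unsplit (inl ord0)) <= degx m)%N by rewrite /degx (bigD1 ord0) //= leq_addr.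
lia.
Qed.

Lemma test_rank_eq0 (j c : int) :
  c != j -> (absz c <= absz j)%N -> test_rank j c = 0%N.
Proof.
move=> cj cjle; apply: fintype.eq_card0 => -[m mP].
have [jc E] := test_rank_ge mP; case/eqP: cj; apply: E.
by apply/eqP; rewrite eqn_leq cjle jc.
Qed.

Lemma test_rank_diag (j : int) : test_rank j j = 1%N.
Proof.
pose l := @unsplit r.+1 s.+1 (test_var j); pose m := mnm_muln (mnm1 l) (absz j).
have md : (mdeg m < (absz j).+1)%N by rewrite mdegMn mdeg1 mul1n.
have mP : low_mnm l (absz j) (BMultinom md).
  have degU d v : degx (mnm_muln (mnm1 (@unsplit r.+1 s.+1 v)) d) =
      (degx (mnm1 (@unsplit r.+1 s.+1 v)) * d)%N /\
    degy (mnm_muln (mnm1 (@unsplit r.+1 s.+1 v)) d) =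
      (degy (mnm1 (@unsplit r.+1 s.+1 v)) * d)%N.
    by rewrite /degx /degy !big_distrl /=; split; apply: eq_bigr => i _; rewrite mulmnE.
  have [mx my] := degU (absz j) (test_var j).
  rewrite /low_mnm /= /bidiff /mindeg mx my degx_mnm1 degy_mnm1 mulmnE mnm1E eqxx.
  by rewrite /test_var; case: ifP => j0 /=; lia.
rewrite /test_rank.
apply: (fintype.eq_card1 (x := exist (fun b : bmultinom n (absz j).+1 =>
  low_mnm l (absz j) b) _ mP)) => -[m' m'P].
rewrite !inE; apply/esym/eqP; apply: val_inj => /=; apply: val_inj => /=.
apply/mnmP => i; have /and3P[/eqP mc /eqP m0 jm] := m'P.
have := mindeg0_mdeg m0; rewrite mc mdegE (bigD1 l) //= => E.
have rest : (\sum_(i0 < n | i0 != l) m' i0)%N = 0%N.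
  by apply/eqP; rewrite -leqn0 -(leq_add2l (m' l)) addn0 E.
rewrite mulmnE mnm1E; have [<-|il] := eqVneq l i.
  by move: E jm; rewrite rest mul1n addn0 -/l => ->.
by apply/eqP; move/eqP: rest; rewrite sum_nat_eq0 => /forallP /(_ i); rewrite eq_sym il.
Qed.

Lemma irrelevant_completion_iso_mod d (M N : lmodType (segre k r s)) :
  completion_iso (@irrelevant k r s) M N -> iso_mod I d M N.
Proof.
pose gen (i : 'I_#|{: 'I_r.+1 * 'I_s.+1}|) :=
  segre_mon k (enum_val i).1 (enum_val i).2.
apply: (@completion_iso_mod _ _ _ gen) => [i|a /irrelevant_gen[h ->]].
  exact: segre_eps_mon.
exists (fun i => h (enum_val i)).
rewrite (reindex_onto enum_val enum_rank) /=; last by move=> p _; rewrite enum_rankK.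
by apply: eq_bigl => i; rewrite enum_valK eqxx.
Qed.

(** Test ranks are additive and invariant modulo [I^2], so both decompositions give the same sum of
    [test_rank j] for every [j], and the triangular system determines the multiplicities. *)
Lemma class_count_unique (F : lmodType (segre k r s)) n1 n2
  (a1 : 'I_n1 -> divisor r s) (a2 : 'I_n2 -> divisor r s) :
  iso_mod I 2 F (dirsum (fun l => divisorial k (a1 l) : lmodType (segre k r s))) ->
  iso_mod I 2 F (dirsum (fun l => divisorial k (a2 l) : lmodType (segre k r s))) ->
  forall c, #|[set l | divisor_class (a1 l) == c]%SET| =
            #|[set l | divisor_class (a2 l) == c]%SET|.
Proof.
move=> F1 F2 c.
pose classes n0 (a : 'I_n0 -> divisor r s) := [seq divisor_class (a l) | l <- enum 'I_n0].
have countE n0 (a : 'I_n0 -> divisor r s) :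
    #|[set l | divisor_class (a l) == c]%SET| = count_mem c (classes n0 a).
  rewrite -sum1_card -sum1_count big_map big_enum_cond.
  by apply: eq_bigl => l; rewrite !inE.
rewrite !countE; apply: (triangular_count test_rank_diag test_rank_eq0) => j.
rewrite !big_map.
have rankE n0 (a : 'I_n0 -> divisor r s) :=
  has_rank_dirsum (fun l => test_rank_divisorial (a l) j).
have [psi [psiL psiA psiS]] := iso_mod_sym F1.
have [psi' [psiL' psiA' psiS']] := F2.
have := has_rank_unique (has_rank_iso psiL' psiA' psiS'
  (has_rank_iso psiL psiA psiS (rankE _ a1))) (rankE _ a2).
rewrite !card_tagged !sumnE !big_map.
by [].
Qed.

(** Ideals of the same class have the same numerators. Conversely, isomorphic completions give two
    decompositions of one module with a single summand each, whose classes must agree. *)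
Lemma divisorial_completion_iso (a b : divisor r s) :
  `[< completion_iso (@irrelevant k r s) (divisorial k a) (divisorial k b) >] =
  (divisor_class a == divisor_class b).
Proof.
apply/asboolP/eqP => [/(irrelevant_completion_iso_mod 2) ab|ab].
  have single (c : divisor r s) : iso_mod I 2 (divisorial k c)
      (dirsum (fun _ : 'I_1 => divisorial k c : lmodType (segre k r s))).
    apply: irrelevant_completion_iso_mod.
    pose M1 (i : 'I_1) : lmodType (segre k r s) := divisorial k c.
    apply: (@bij_linear_completion_iso _ _ _ _ (@dirsum_proj _ _ M1 ord0)).
      exact: dirsum_proj_is_linear.
    exists (@dirsum_inj _ _ M1 ord0) => f.
      apply/ffunP => i; rewrite (ord1 i) dirsum_injE.
      by [].
    by rewrite /dirsum_proj dirsum_injE.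
  have := class_count_unique (single a) (iso_mod_trans ab (single b)) (divisor_class a).
  set A := finset _; set B := finset _.
  have -> : A = [set: 'I_1]%SET by apply/setP => l; rewrite !inE eqxx.
  rewrite cardsT card_ord => /esym cB; have : (0 < #|B|)%N by rewrite cB.
  by case/card_gt0P => l; rewrite inE => /eqP.
have num_ab z : supported (bidiff_eq (divisor_class a)) (@numerator k r s b z).
  by rewrite ab; exact: numerator_supported.
have num_ba z : supported (bidiff_eq (divisor_class b)) (@numerator k r s a z).
  by rewrite -ab; exact: numerator_supported.
apply: (@bij_linear_completion_iso _ _ _ _ (fun z => of_numerator (num_ab z))).
  move=> c z w; apply: numerator_inj; rewrite of_numeratorK !numeratorP.
  by rewrite !of_numeratorK.
by exists (fun z => of_numerator (num_ba z)) => z;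
  apply: numerator_inj; rewrite !of_numeratorK.
Qed.
End Multiplicities.

(** * The decomposition of the Frobenius root *)

Section FrobeniusDecomposition.
Variables (k : closedFieldType) (p : nat) (pk : p \in [pchar k]) (r s e : nat).
Local Notation n := (r.+1 + s.+1)%N.
Local Notation q := (p ^ e)%N.
Implicit Types (f g : mpoly n k) (m : multinom n).

Lemma q_gt0 : (0 < q)%N.
Proof. by rewrite expn_gt0 prime_gt0 ?(pcharf_prime pk). Qed.

Lemma mpoly_pchar : p \in [pchar (mpoly n k)].
Proof.
rewrite !inE (pcharf_prime pk) /=; apply/eqP.
have -> : p%:R = (p%:R : k) *: (1 : mpoly n k) by rewrite scaler_nat.
by rewrite (pcharf0 pk) scale0r.
Qed.

Lemma exprqD (A : comNzRingType) (x y : A) :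
  p \in [pchar A] -> (x + y) ^+ q = x ^+ q + y ^+ q.
Proof.
by move=> pA; rewrite exprDn_pchar // pnatX (pnatE _ (pcharf_prime pk)) pA.
Qed.

Lemma exprq_sum (J : Type) (l : seq J) (F : J -> mpoly n k) :
  (\sum_(j <- l) F j) ^+ q = \sum_(j <- l) F j ^+ q.
Proof.
apply: (big_morph (fun f => f ^+ q)) => [f g|].
  exact: (exprqD _ _ mpoly_pchar).
by rewrite expr0n eqn0Ngt q_gt0.
Qed.

Lemma exprqX f : f ^+ q =
  \sum_(m <- msupp f) (mcoeff m f) ^+ q *: mpolyX k (mnm_muln m q).
Proof.
rewrite {1}(mpolyE f) exprq_sum; apply: eq_bigr => m _.
by rewrite exprZn mpolyXn.
Qed.

Lemma mnm_muln_inj m m' : mnm_muln m q = mnm_muln m' q -> m = m'.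
Proof.
move=> /mnmP mm; apply/mnmP => i; have := mm i; rewrite !mulmnE => /eqP.
by rewrite eqn_pmul2r ?q_gt0 // => /eqP.
Qed.

Lemma mcoeff_exprq f m : mcoeff (mnm_muln m q) (f ^+ q) = mcoeff m f ^+ q.
Proof.
rewrite exprqX raddf_sum /=; under eq_bigr do rewrite mcoeffZ mcoeffX.
have [mf|mf] := boolP (m \in msupp f).
  rewrite (bigD1_seq m) ?msupp_uniq //= eqxx mulr1 big1 ?addr0 // => m' mm'.
  case: eqP => [/mnm_muln_inj mE|]; last by rewrite mulr0.
  by rewrite mE eqxx in mm'.
rewrite big_seq big1 => [|m' m'f].
  by rewrite (eqP (_ : mcoeff m f == 0)) ?mcoeff_eq0 // expr0n eqn0Ngt q_gt0.
case: eqP => [/mnm_muln_inj mE|]; last by rewrite mulr0.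
by rewrite mE (negPf mf) in m'f.
Qed.

Lemma root_exists (c : k) : exists b, b ^+ q = c.
Proof.
have : size ('X^q - c%:P : {poly k}) != 1%N.
  by rewrite size_XnsubC ?q_gt0 //; have := q_gt0; case: q.
move=> /closed_rootP[b]; rewrite rootE !hornerE ?hornerXn subr_eq0 => /eqP bc.
by exists b.
Qed.
Local Notation box := {ffun 'I_n -> 'I_q}.
Implicit Types w : box.

Definition box_mnm w : multinom n := Multinom [tuple nat_of_ord (w i) | i < n].

Lemma box_mnmE w i : box_mnm w i = w i.
Proof. by rewrite multinomE tnth_mktuple. Qed.

Definition mnm_mod m : box := [ffun i => Ordinal (ltn_pmod (m i) q_gt0)].
Definition mnm_div m : multinom n := Multinom [tuple (m i %/ q)%N | i < n].

Lemma mnm_divE m i : mnm_div m i = (m i %/ q)%N.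
Proof. by rewrite multinomE tnth_mktuple. Qed.

Lemma mnm_divn_eq m : m = box_mnm (mnm_mod m) |+| mnm_muln (mnm_div m) q.
Proof.
apply/mnmP => i; rewrite mnmDE box_mnmE ffunE mulmnE mnm_divE /=.
by rewrite [RHS]addnC -divn_eq.
Qed.

Lemma mnm_modK w m : mnm_mod (box_mnm w |+| mnm_muln m q) = w.
Proof.
apply/ffunP => i; apply: val_inj; rewrite ffunE /= mnmDE box_mnmE mulmnE.
by rewrite [X in (X %% _)%N]addnC modnMDl modn_small.
Qed.

Lemma bidiff_mulmn m : bidiff (mnm_muln m q) = bidiff m * q%:Z.
Proof.
rewrite /bidiff mulrBl -!PoszM /degx /degy !big_distrl /=.
by congr (Posz _ - Posz _); apply: eq_bigr => i _; rewrite mulmnE.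
Qed.

Lemma bidiff_divn_eq m :
  bidiff m = bidiff (box_mnm (mnm_mod m)) + bidiff (mnm_div m) * q%:Z.
Proof. by rewrite -bidiff_mulmn -bidiffD -mnm_divn_eq. Qed.

(** A monomial of the Segre product has [bidiff] 0, so its residue vector modulo [q] has [bidiff]
    divisible by [q]. *)
Definition split_box : finType := {w : box | (q %| bidiff (box_mnm w))%Z}.

(** When [w + q m'] has [bidiff] 0, this is [bidiff m']. *)
Definition box_class w : int := - (bidiff (box_mnm w) %/ q)%Z.

Lemma divisor_class_class_divisor c :
  divisor_class (class_divisor c : divisor r s) = c.
Proof.
rewrite /divisor_class (bigD1 ord0) //= /class_divisor eqxx big1 => [|i i0].
  by rewrite big1 ?addr0 ?subr0 // => j _.
by case: eqP => // -[ii]; rewrite ii eqxx in i0.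
Qed.

Local Notation M := (fun l : 'I_#|split_box| =>
  divisorial k (class_divisor (box_class (val (enum_val l)))) : lmodType (segre k r s)).

(** The [q]-th power of the sum of the [X^(w/q) f_w], since an element of the Frobenius root is
    represented by its [q]-th power. *)
Definition frobenius_poly (u : dirsum M) : mpoly n k :=
  \sum_l mpolyX k (box_mnm (val (enum_val l))) * numerator (u l) ^+ q.

Lemma frobenius_poly_supported (u : dirsum M) :
  supported (bidiff_eq 0) (frobenius_poly u).
Proof.
apply: supported_sum => l _.
apply: (supportedM (P := [set m | m = box_mnm (val (enum_val l))])
  (P' := [set m | exists2 m', bidiff_eq (box_class (val (enum_val l))) m'
                  & m = mnm_muln m' q])).
- move=> _ m -> [m' m'l ->]; rewrite /bidiff_eq /= bidiffD bidiff_mulmn.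
  move: m'l; rewrite /bidiff_eq /= => ->; rewrite /box_class mulNr.
  by rewrite divzK ?subrr //; case: (enum_val l).
- exact: supportedX.
- rewrite exprqX; apply: supported_sum => m; rewrite mcoeff_msupp => mf.
  apply: supportedZ; apply: supportedX; exists m => //.
  by have := numerator_supported mf; rewrite divisor_class_class_divisor.
Qed.

Definition frobenius_map (u : dirsum M) : frobenius_root (segre_pchar r s pk) e :=
  segre_poly (@frobenius_poly_supported u).

Lemma frobenius_map_linear : linear frobenius_map.
Proof.
move=> a u v; apply: val_inj.
suff : frobenius_poly (a *: u + v) =
    (segre_val a : mpoly n k) ^+ q * frobenius_poly u + frobenius_poly v.
  have aq : (segre_val (a ^+ q) : mpoly n k) = (segre_val a : mpoly n k) ^+ q.
    exact: (rmorphXn (val : segre k r s -> xy_ring k r s)).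
  move=> uv; rewrite -[RHS]/(segre_val (a ^+ q * (frobenius_map u : segre k r s)
    + (frobenius_map v : segre k r s)) : mpoly n k).
  by rewrite segre_valD segre_valM aq; exact: uv.
rewrite /frobenius_poly mulr_sumr -big_split; apply: eq_bigr => l _ /=.
have -> : (a *: u + v) l = a *: u l + v l by rewrite !ffunE.
by rewrite numeratorP (exprqD _ _ mpoly_pchar) exprMn mulrDr mulrCA.
Qed.

(** Different residue vectors give disjoint sets of monomials, so the terms do not interfere. *)
Lemma mcoeff_frobenius_poly (u : dirsum M) l m :
  mcoeff (box_mnm (val (enum_val l)) |+| mnm_muln m q) (frobenius_poly u) =
  mcoeff m (numerator (u l)) ^+ q.
Proof.
rewrite raddf_sum (bigD1 l) //= mulrC mcoeffMX mcoeff_exprq big1 ?addr0 // => l' l'l.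
apply/eqP; apply: contraNT l'l; rewrite -mcoeff_msupp.
move=> /msuppM_le /allpairsP[[m1 m2] /=].
rewrite mcoeff_msupp mcoeffX.
have [<- [_ m2u mE]|_ []] := eqVneq (box_mnm (val (enum_val l'))) m1; last first.
  by rewrite eqxx.
have [m' m2E] : exists m', m2 = mnm_muln m' q.
  move: m2u; rewrite exprqX => /msupp_sum_le /flattenP[_ /mapP[m' _ ->]].
  by move=> /msuppZ_le; rewrite msuppX inE => /eqP ->; exists m'.
have := congr1 mnm_mod mE; rewrite m2E !mnm_modK => /val_inj /enum_val_inj ->.
exact: eqxx.
Qed.

(** Injectivity reduces to that of the Frobenius of [k]. For surjectivity, the monomials of [y] are
    grouped by residue vector, and [q]-th roots of their coefficients exist as [k] is algebraically
    closed. *)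
Lemma frobenius_map_bij : bijective frobenius_map.
Proof.
have inj : injective frobenius_map.
  move=> u v /(congr1 (fun x : segre k r s => segre_val x : mpoly n k)) uv.
  apply/ffunP => l; apply: numerator_inj; apply/mpolyP => m; apply/eqP.
  have : mcoeff m (numerator (u l)) ^+ q = mcoeff m (numerator (v l)) ^+ q.
    by rewrite -!mcoeff_frobenius_poly; congr mcoeff; exact: uv.
  have qN (x : k) : (- x) ^+ q = - x ^+ q.
    apply/eqP; rewrite -subr_eq0 opprK -(exprqD _ _ pk) addNr.
    by rewrite expr0n eqn0Ngt q_gt0.
  move=> /eqP; rewrite -subr_eq0 -qN -(exprqD _ _ pk) expf_eq0 subr_eq0.
  by case/andP.
suff /choice[psi psiK] y : exists u, frobenius_map u = y.
  by exists psi => // u; apply: inj; rewrite psiK.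
pose f : mpoly n k := segre_val (y : segre k r s).
have [b bP] := choice root_exists.
pose g w := \sum_(m <- msupp f | mnm_mod m == w) b (mcoeff m f) *: mpolyX k (mnm_div m).
have f0 m : m \in msupp f -> bidiff m = 0.
  by rewrite mcoeff_msupp; exact: segre_supported.
have gS w : supported
    (bidiff_eq (divisor_class (class_divisor (box_class w) : divisor r s))) (g w).
  rewrite divisor_class_class_divisor /g big_mkcond; apply: supported_sum => m /f0 m0.
  case: eqP => [mw|_]; last exact: supported0.
  apply: supportedZ; apply: supportedX; rewrite /bidiff_eq /box_class /=.
  move: m0; rewrite bidiff_divn_eq mw => /eqP; rewrite addr_eq0 => /eqP ->.
  rewrite -mulNr mulzK ?opprK //; have := q_gt0; lia.
exists [ffun l => of_numerator (gS (val (enum_val l)))].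
apply: val_inj; transitivity (f : xy_ring k r s); last by [].
rewrite /= /frobenius_poly.
have termE w : mpolyX k (box_mnm w) * g w ^+ q =
    \sum_(m <- msupp f) if mnm_mod m == w then mcoeff m f *: mpolyX k m else 0.
  rewrite /g -big_filter exprq_sum big_filter mulr_sumr -big_mkcond /=.
  apply: eq_bigr => m /eqP <-.
  by rewrite exprZn bP mpolyXn -scalerAr -mpolyXD -mnm_divn_eq.
under eq_bigr do rewrite ffunE of_numeratorK termE.
rewrite exchange_big /= [RHS](mpolyE f) !big_seq; apply: eq_bigr => m mf.
have mJ : (q %| bidiff (box_mnm (mnm_mod m)))%Z.
  move: (f0 m mf); rewrite bidiff_divn_eq => /eqP; rewrite addr_eq0 => /eqP ->.
  by rewrite rpredN dvdz_mull.
pose w : split_box := exist (fun w : box => (q %| bidiff (box_mnm w))%Z) _ mJ.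
rewrite -big_mkcond (big_pred1 (enum_rank w)) // => l.
rewrite -[RHS]/(l == enum_rank w); apply/eqP/eqP => [ml|->].
  by apply: enum_val_inj; rewrite enum_rankK; exact: val_inj.
by rewrite enum_rankK.
Qed.
End FrobeniusDecomposition.

(** * Multiplicities as numbers of residue vectors *)

Section Multiplicity.
Variables (R : realType) (k : closedFieldType) (p : nat) (pk : p \in [pchar k]).
Variables (r s : nat) (r_gt0 : (0 < r)%N) (s_gt0 : (0 < s)%N) (e : nat).
Local Notation n := (r.+1 + s.+1)%N.
Local Notation q := (p ^ e)%N.
Local Notation box := {ffun 'I_n -> 'I_q}.

Lemma conic_class_divisor (w : box) : (q %| bidiff (box_mnm w))%Z ->
  conic R (class_divisor (box_class w) : divisor r s).
Proof.
move=> qw; have q0 := q_gt0 pk e.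
have qR : q%:R != 0 :> R by rewrite pnatr_eq0 -lt0n.
pose c := box_class w.
(* The values of the forms [sigma] at the required real point. Their ceilings are right since
   [0 <= w/q < 1], and their two sums agree since [q c = degx - degy] on [w]. *)
pose b v : R := (class_divisor c v : int)%:~R - (w (unsplit v))%:R / q%:R.
have sumx : \sum_(i < r.+1) (class_divisor c (inl i : 'I_r.+1 + 'I_s.+1))%:~R =
    c%:~R :> R.
  rewrite (bigD1 ord0) //= /class_divisor eqxx big1 ?addr0 // => i i0.
  by case: eqP => // -[ii]; rewrite ii eqxx in i0.
have wx : \sum_(i < r.+1) (w (unsplit (inl i)))%:R = (degx (box_mnm w))%:R :> R.
  by rewrite /degx natr_sum; apply: eq_bigr => i _; rewrite box_mnmE.
have wy : \sum_(j < s.+1) (w (unsplit (inr j)))%:R = (degy (box_mnm w))%:R :> R.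
  by rewrite /degy natr_sum; apply: eq_bigr => i _; rewrite box_mnmE.
have [|x xb] := sigma_surj (b := b).
  rewrite /b !sumrB -!mulr_suml wx wy sumx [X in _ = X - _]big1 // sub0r.
  have : bidiff (box_mnm w) = - c * q%:Z by rewrite /c /box_class opprK divzK.
  move=> /(congr1 (fun z : int => z%:~R : R)).
  rewrite /bidiff rmorphB rmorphM rmorphN /= -!pmulrn => E.
  apply: (mulIf qR); rewrite mulrBl mulNr !divfK //.
  by lra.
exists x => v; rewrite xb /b; apply/esym/ceil_def.
have /andP[wq0 wq1] : 0 <= ((w (unsplit v))%:R / q%:R : R) < 1.
  by rewrite divr_ge0 //= ltr_pdivrMr ?ltr0n // mul1r ltr_nat ltn_ord.
by rewrite rmorphB /=; lra.
Qed.

(** The Frobenius decomposition provides one witness, and by [class_count_unique] every other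
    decomposition gives the same number. *)
Lemma is_multiplicityP c m :
  is_multiplicity R pk e (divisorial k (class_divisor c : divisor r s)) m <->
  m = #|[set w : box | bidiff (box_mnm w) == - (c * q%:Z)]%SET|.
Proof.
pose a (l : 'I_#|split_box p r s e|) : divisor r s :=
  class_divisor (box_class (val (enum_val l))).
have iso : completion_iso (@irrelevant k r s) (frobenius_root (segre_pchar r s pk) e)
    (dirsum (fun l => divisorial k (a l) : lmodType (segre k r s))).
  apply: (@bij_linear_completion_iso _ _ _ _ (@frobenius_map k p pk r s e)).
    exact: frobenius_map_linear.
  exact: frobenius_map_bij.
have countE n1 (b : 'I_n1 -> divisor r s) :
    #|[set l | `[< completion_iso (@irrelevant k r s) (divisorial k (b l))
        (divisorial k (class_divisor c : divisor r s)) >]]| =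
    #|[set l | divisor_class (b l) == c]%SET|.
  apply: fintype.eq_card => l; rewrite [RHS]inE.
  rewrite -[X in _ == X](divisor_class_class_divisor r s c) -(divisorial_completion_iso k) //.
  by apply/idP/idP => [/set_mem|/mem_set].
have boxE : #|[set l | divisor_class (a l) == c]%SET| =
    #|[set w : box | bidiff (box_mnm w) == - (c * q%:Z)]%SET|.
  have q0 := q_gt0 pk e.
  rewrite -(card_imset _ (inj_comp val_inj enum_val_inj)); apply: fintype.eq_card => w.
  rewrite [RHS]inE; apply/imsetP/eqP => [[l]|wc].
    rewrite inE divisor_class_class_divisor => /eqP <- -> /=.
    by rewrite /box_class mulNr opprK divzK //; case: (enum_val l).
  have wJ : (q %| bidiff (box_mnm w))%Z by rewrite wc -mulNr dvdz_mull.
  pose w' : split_box p r s e :=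
    exist (fun w : box => (q %| bidiff (box_mnm w))%Z) _ wJ.
  exists (enum_rank w'); last by rewrite /= enum_rankK.
  rewrite inE divisor_class_class_divisor enum_rankK /box_class /= wc -mulNr.
  rewrite mulzK ?opprK //; lia.
split=> [[n1 [b [_ isob ->]]]|->].
  rewrite countE -boxE; exact: (class_count_unique r_gt0 s_gt0
    (irrelevant_completion_iso_mod 2 isob) (irrelevant_completion_iso_mod 2 iso)).
exists #|split_box p r s e|, a; split=> //; last by rewrite countE boxE.
by move=> l; apply: conic_class_divisor; case: (enum_val l).
Qed.

(** The set of multiplicities is a singleton, so [xget] does not return its default 0. *)
Lemma multiplicityE c :
  multiplicity R pk e (divisorial k (class_divisor c : divisor r s)) =
  #|[set w : box | bidiff (box_mnm w) == - (c * q%:Z)]%SET|.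
Proof.
rewrite /multiplicity; case: xgetP => [m _ /is_multiplicityP//|/(_ _)].
by move=> none; exfalso; apply: (none _); apply/is_multiplicityP.
Qed.
End Multiplicity.

(** * Counting *)

Section CyclicPartialSums.
Variable q : nat.
Hypothesis q_gt0 : (0 < q)%N.
Implicit Types (a x y : 'I_q) (zs ys : seq 'I_q).

Fixpoint psum a zs : seq 'I_q :=
  if zs is x :: zs' then
    let y := Ordinal (ltn_pmod (a + x) q_gt0) in y :: psum y zs'
  else [::].

Fixpoint desc_from a ys : nat :=
  if ys is y :: ys' then ((y < a) + desc_from y ys')%N else 0%N.

Lemma size_psum a zs : size (psum a zs) = size zs.
Proof. by elim: zs a => //= x zs IHzs a; rewrite IHzs. Qed.

Lemma psum_inj a : injective (psum a).
Proof.
move=> zs; elim: zs a => [|x zs IHzs] a [|x' zs'] //= [xx' pp].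
have E : x = x'.
  apply: val_inj => /=; move/eqP: xx'; rewrite eqn_modDl !modn_small //.
  by move/eqP.
by rewrite -E in pp *; rewrite (IHzs _ _ pp).
Qed.

(* A partial sum modulo q is a descent exactly when the addition carries. *)
Lemma psum_desc a zs : (a + \sum_(z <- zs) (z : nat) =
  q * desc_from a (psum a zs) + last a (psum a zs))%N.
Proof.
elim: zs a => [|x zs IHzs] a; first by rewrite big_nil muln0 addn0.
rewrite big_cons addnA {1}(divn_eq (a + x) q) -addnA.
rewrite (IHzs (Ordinal (ltn_pmod (a + x) q_gt0))) /= mulnDr -!addnA mulnC.
congr (_ * _ + _)%N.
have aq := ltn_ord a; have xq := ltn_ord x.
have [ax|ax] := ltnP (a + x) q.
  by rewrite divn_small // modn_small // ltnNge leq_addr.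
(* Both summands are below [q], so a carry is exactly 1. *)
have d1 : ((a + x) %/ q = 1)%N.
  by apply/eqP; rewrite eqn_leq -ltnS ltn_divLR // leq_divRL //; lia.
by have := divn_eq (a + x) q; rewrite d1; lia.
Qed.
End CyclicPartialSums.

(** * Counting tuples by their sum *)

Section BoxCount.
Variables (q s t : nat).
Hypothesis sq : (s < q)%N.
Let q_gt0 : (0 < q)%N := leq_ltn_trans (leq0n s) sq.

(** The first entry must be [q (t + 1) - (s + 1) - S], with [S] the sum of the others; this lies in
    [[0, q)] exactly when [s + S] has quotient [t] by [q]. *)
Lemma card_tuple_sum d n : n = d.+1 ->
  #|[set z : n.-tuple 'I_q | (s.+1 + \sum_(x <- z) (x : nat) == q * t.+1)%N]%SET| =
  #|[set z : d.-tuple 'I_q | ((s + \sum_(x <- z) (x : nat)) %/ q == t)%N]%SET|.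
Proof.
move=> ->; pose f (z : d.+1.-tuple 'I_q) := [tuple of behead z].
have fin : {in [set z : d.+1.-tuple 'I_q |
    (s.+1 + \sum_(x <- z) (x : nat) == q * t.+1)%N]%SET &, injective f}.
  move=> /tupleP[x z] /tupleP[x' z']; rewrite !inE /= !big_cons => /eqP zE /eqP zE' ff.
  have zz : z = z' by apply: val_inj; exact: (congr1 val ff).
  rewrite -zz in zE' *; congr [tuple of _ :: _]; apply: val_inj => /=; lia.
rewrite -(card_in_imset fin); apply: fintype.eq_card => z; rewrite [RHS]inE.
apply/imsetP/eqP => [[/tupleP[x z']]|zt].
  rewrite inE /= big_cons => /eqP zE ->.
  have -> : (\sum_(y <- f [tuple of x :: z']) (y : nat) =
    \sum_(y <- z') (y : nat))%N by [].
  have xq := ltn_ord x.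
  have -> : (s + \sum_(y <- z') (y : nat) = t * q + (q - x.+1))%N.
    by move: zE; rewrite mulnS; set S := (\sum_(y <- z') (y : nat))%N; lia.
  by rewrite divnMDl // divn_small ?addn0 //; lia.
have := divn_eq (s + \sum_(x <- z) (x : nat)) q; rewrite zt => zE.
have rq := ltn_pmod (s + \sum_(x <- z) (x : nat)) q_gt0.
set S := (\sum_(x <- z) (x : nat))%N in zE rq.
set rest := ((s + S) %% q)%N in zE rq.
have xq : (q - rest.+1 < q)%N by lia.
exists [tuple of (Ordinal xq) :: z]; last by apply: val_inj.
by rewrite inE /= big_cons /= -/S mulnS; apply/eqP; move: zE rq; lia.
Qed.

(** Partial sums starting from [s] define an injective self-map of a finite set, hence a bijection;
    the last partial sum is below [q], so the quotient is the number of carries. *)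
Lemma card_tuple_desc d :
  #|[set z : d.-tuple 'I_q | ((s + \sum_(x <- z) (x : nat)) %/ q == t)%N]%SET| =
  #|[set y : d.-tuple 'I_q | desc_from (Ordinal sq) y == t]%SET|.
Proof.
have psP (z : d.-tuple 'I_q) : size (psum q_gt0 (Ordinal sq) z) == d.
  by rewrite size_psum size_tuple.
pose f z := Tuple (psP z).
have finj : injective f.
  by move=> z z' /(congr1 val) /psum_inj; exact: val_inj.
rewrite -[RHS](on_card_preimset (f := f)); last exact/onW_bij/injF_bij.
apply: fintype.eq_card => z; rewrite !inE.
have := psum_desc q_gt0 (Ordinal sq) z; rewrite /= => ->.
by rewrite mulnC divnMDl // divn_small // addn0.
Qed.
End BoxCount.

(** * Descents of words *)

Definition desc_count d (f : 'I_d -> nat) : nat :=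
  #|[set i : 'I_d | [exists j : 'I_d, (j == i.+1 :> nat) && (f j < f i)%N]]%SET|.

Lemma desc_countE m (f : 'I_m.+1 -> nat) :
  desc_count f = (\sum_(i < m) (f (inord i.+1) < f (inord i)))%N.
Proof.
rewrite /desc_count -sum1_card big_mkcond big_ord_recr /=.
rewrite [X in (_ + X)%N]ifF ?addn0; last first.
  rewrite inE; apply/existsP => -[j /andP[/eqP jm _]].
  by have := ltn_ord j; rewrite jm ltnn.
apply: eq_bigr => i _; rewrite inE; have i1 : (i.+1 < m.+1)%N by rewrite ltnS.
have iE : inord i = widen_ord (leqnSn m) i.
  by apply: val_inj; rewrite /= inordK //; exact: ltnW.
rewrite iE; case: ifP => [/existsP[j /andP[/eqP ji fj]]|/existsP nij].
  have -> : inord i.+1 = j by apply: val_inj; rewrite /= inordK // ji.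
  by rewrite fj.
apply/esym/eqP; rewrite eqb0; apply/negP => fi.
by case: nij; exists (inord i.+1); rewrite inordK // eqxx.
Qed.

Lemma descentsE d (w : 'S_d) : descents w = desc_count (fun i => w i).
Proof.
rewrite /descents /desc_count; apply: fintype.eq_card => i; rewrite [RHS]inE.
by apply/idP/idP => [/set_mem|/mem_set].
Qed.

Lemma desc_from_nth q m (a y : 'I_q) (ys : seq 'I_q) : size ys = m.+1 ->
  desc_from a ys = ((nth y ys 0 < a) +
    \sum_(i < m) (nth y ys i.+1 < nth y ys i))%N.
Proof.
elim: m a ys => [|m IHm] a [//|z zs] /= [zm].
  by move/size0nil: zm => ->; rewrite big_ord0.
by rewrite (IHm z) // big_ord_recl /=; case: zs zm {IHm}.
Qed.

Lemma desc_fromE q m (a : 'I_q) (ys : m.+1.-tuple 'I_q) :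
  desc_from a ys = ((thead ys < a) + desc_count (fun i => tnth ys i))%N.
Proof.
rewrite desc_countE (@desc_from_nth _ m _ a) ?size_tuple // /thead (tnth_nth a).
congr (_ + _)%N; apply: eq_bigr => i _.
by rewrite !(tnth_nth a) !inordK // ltnS // ltnW.
Qed.

(** * Injective words as increasing words with a pattern *)

Section PermutationPatterns.
Variables (d q : nat).
Implicit Types (t y : d.-tuple 'I_q) (w : 'S_d).

(** For an increasing first component, the word with those letters whose pattern is the second
    component. *)
Definition arrange (x : d.-tuple 'I_q * 'S_d) : d.-tuple 'I_q :=
  [tuple tnth x.1 (x.2 i) | i < d].

Lemma arrange_perm x : perm_eq (arrange x) x.1.
Proof. by apply/tuple_permP; exists x.2. Qed.

Definition increasing : {set d.-tuple 'I_q} :=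
  [set t : d.-tuple 'I_q | sorted ltn (map val t)]%SET.

Lemma increasing_uniq t : t \in increasing -> uniq t.
Proof.
rewrite inE => /(sorted_uniq ltn_trans ltnn); exact: map_uniq.
Qed.

Lemma increasing_lt t i j : t \in increasing -> (tnth t i < tnth t j)%N = (i < j)%N.
Proof.
move=> tinc; have := tinc; rewrite inE => ts.
have lt_homo (a b : 'I_d) : (a < b)%N -> (tnth t a < tnth t b)%N.
  move=> ab; have sz : size (map val t) = d by rewrite size_map size_tuple.
  have /(_ (a : nat) (b : nat)) := sorted_ltn_nth ltn_trans 0%N ts.
  rewrite !inE sz !ltn_ord => /(_ isT isT ab).
  by rewrite !(nth_map (tnth t a)) ?size_tuple ?ltn_ord // -!tnth_nth.
have [/lt_homo ->//|ji] := ltnP i j; apply/negbTE; rewrite -leqNgt.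
move: ji; rewrite leq_eqVlt => /predU1P[ji|/lt_homo/ltnW//].
by have -> : j = i by exact: val_inj.
Qed.

Lemma arrange_inj : {in finset.setX increasing [set: 'S_d]%SET &, injective arrange}.
Proof.
move=> [t w] [t' w']; rewrite !inE !andbT /= => ts ts' E.
have tt' : t = t'.
  apply: val_inj; apply: (inj_map val_inj).
  apply: (irr_sorted_eq ltn_trans ltnn ts ts') => x.
  apply/mapP/mapP => -[z zt ->]; exists z => //.
    by rewrite -(perm_mem (arrange_perm (t', w'))) -E (perm_mem (arrange_perm (t, w))).
  by rewrite -(perm_mem (arrange_perm (t, w))) E (perm_mem (arrange_perm (t', w'))).
rewrite -tt' in E *; congr (_, _); apply/permP => i.
have tu : uniq t by apply: increasing_uniq; rewrite inE.
have := congr1 (fun y => tnth y i) E; rewrite !tnth_mktuple /=.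
by move/(tuple_uniqP _ tu).
Qed.

(** Sorting separates the letters of an injective word from its pattern, which has the same
    descents; there are ['C(q, d)] choices of letters. *)
Lemma card_arranged n :
  #|[set y : d.-tuple 'I_q | uniq y && (desc_count (fun i => tnth y i) == n)]%SET|
  = ('C(q, d) * eulerian n.+1 d)%N.
Proof.
have -> : eulerian n.+1 d = #|[set w : 'S_d | desc_count (fun i => w i) == n]%SET|.
  apply: fintype.eq_card => w; rewrite [RHS]inE -descentsE.
  by apply/idP/idP => [/set_mem|wn]; [|apply: mem_set].
rewrite -(card_ltn_sorted_tuples d q) -cardsX.
rewrite -(card_in_imset (f := arrange)) //; last first.
  move=> x x'; rewrite !inE => /andP[xs _] /andP[xs' _].
  by apply: arrange_inj; rewrite !inE ?xs ?xs'.
apply: fintype.eq_card => y; rewrite inE; apply/andP/imsetP.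
  move=> [yu yn]; pose leo := relpre (val : 'I_q -> nat) leq.
  pose t := [tuple of sort leo y].
  have ts : sorted ltn (map val t).
    rewrite ltn_sorted_uniq_leq map_inj_uniq ?sort_uniq ?yu /=; last exact: val_inj.
    rewrite sorted_map; apply: sort_sorted => a b; exact: leq_total.
  have /tuple_permP[w yE] : perm_eq y t by rewrite perm_sym perm_sort.
  have {}yE : y = arrange (t, w) by exact: val_inj yE.
  exists (t, w) => //; rewrite !inE ts /=; move: yn; rewrite yE => /eqP <-.
  apply/eqP; apply: fintype.eq_card => i; rewrite !inE; apply: eq_existsb => l.
  by rewrite !tnth_mktuple increasing_lt // inE.
move=> [[t w]]; rewrite !inE /= => /andP[ts /eqP wn] ->; split.
  by rewrite (perm_uniq (arrange_perm (t, w))) increasing_uniq ?inE.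
rewrite -wn; apply/eqP; apply: fintype.eq_card => i; rewrite !inE; apply: eq_existsb => l.
by rewrite !tnth_mktuple increasing_lt // inE.
Qed.
End PermutationPatterns.

(** This bounds the number of non-injective words; the induction rests on
    [(m+1)^2 + (m+1) <= (m+2)^2]. *)
Lemma expn_ffact_bound q m : (q ^ m.+1 <= q ^_ m.+1 + m.+1 ^ 2 * q ^ m)%N.
Proof.
elim: m => [|m IHm]; first by rewrite expn1 ffactn1 leq_addr.
have le : (q ^_ m.+1 <= q ^ m.+1)%N.
  elim: (m.+1) => // j IHj; rewrite ffactnSr expnSr leq_mul //; exact: leq_subr.
have E : (q ^_ m.+1 * q <= q ^_ m.+2 + m.+1 * q ^ m.+1)%N.
  rewrite (ffactnSr q m.+1); apply: (@leq_trans (q ^_ m.+1 * (q - m.+1 + m.+1))%N).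
    by rewrite leq_mul2l; apply/orP; right; lia.
  by rewrite mulnDr leq_add2l mulnC leq_mul2l le orbT.
rewrite expnSr; apply: leq_trans (leq_mul IHm (leqnn q)) _.
rewrite mulnDl -mulnA -expnSr; apply: leq_trans (leq_add E (leqnn _)) _.
by rewrite -addnA leq_add2l -mulnDl leq_mul2r; apply/orP; right; nia.
Qed.

(** * Counting words by descents, up to lower order terms *)

Section DescentCounts.
Variables (q s m t : nat).
Hypothesis sq : (s < q)%N.
Local Notation T := (m.+1.-tuple 'I_q).
Let D := [set y : T | desc_from (Ordinal sq) y == t]%SET.
Let U := [set y : T | uniq y && (desc_count (fun i => tnth y i) == t)]%SET.
Let B := [set y : T | (thead y < s)%N]%SET.

Lemma card_small_head : (#|B| <= s * q ^ m)%N.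
Proof.
pose f (y : T) := (thead y, [tuple of behead y]).
have finj : injective f.
  move=> /tupleP[x y] /tupleP[x' y'] E; apply: val_inj => /=.
  have := congr1 fst E; rewrite /= !theadE => ->.
  by have /= -> := congr1 (fun z => val z.2) E.
rewrite -(card_imset _ finj).
apply: (@leq_trans
  #|finset.setX [set x : 'I_q | (x < s)%N]%SET [set: m.-tuple 'I_q]%SET|).
  apply: subset_leq_card; apply/fintype.subsetP => _ /imsetP[y yB ->].
  by rewrite inE; move: yB; rewrite !inE andbT.
rewrite cardsX cardsT card_tuple card_ord leq_mul2r; apply/orP; right.
rewrite -sum1_card (eq_bigl (fun x : 'I_q => (x < s)%N)) => [|x]; last by rewrite inE.
by rewrite (big_ord_narrow (ltnW sq)) sum1_card card_ord.
Qed.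

Lemma card_not_uniq : #|[set y : T | ~~ uniq y]%SET| = (q ^ m.+1 - q ^_ m.+1)%N.
Proof.
have -> : [set y : T | ~~ uniq y]%SET = (~: [set y : T | all xpredT y & uniq y])%SET.
  by apply/finset.setP => y; rewrite !inE all_predT.
by rewrite cardsCs finset.setCK card_uniq_tuples card_tuple !card_ord.
Qed.

(** Putting [s] in front creates no new descent unless the first letter is below [s]. So [D] exceeds
    [U] only by non-injective words and words of [B], and [U] exceeds [D] only by words of [B]. *)
Lemma desc_from_bounds :
  (#|D| <= #|U| + (m.+1 ^ 2 + s) * q ^ m)%N /\ (#|U| <= #|D| + s * q ^ m)%N.
Proof.
have DU : (#|D| <= #|U| + #|[set y : T | ~~ uniq y]%SET| + #|B|)%N.
  apply: leq_trans (subset_leq_card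
    (_ : D \subset (U :|: [set y : T | ~~ uniq y] :|: B)%SET)) _.
    apply/fintype.subsetP => y; rewrite !inE desc_fromE /=.
    case: ltnP => _; rewrite ?orbT // add0n => ->.
    by case: (uniq y); rewrite ?orbT.
  apply: leq_trans (leq_of_leqif (leq_card_setU _ _)) _; rewrite leq_add2r.
  exact: leq_of_leqif (leq_card_setU _ _).
have UD : (#|U| <= #|D| + #|B|)%N.
  apply: leq_trans (subset_leq_card (_ : U \subset (D :|: B)%SET)) _.
    apply/fintype.subsetP => y; rewrite !inE desc_fromE /=.
    by case: ltnP => _; rewrite ?orbT // add0n orbF => /andP[].
  exact: leq_of_leqif (leq_card_setU _ _).
have := card_small_head; have := expn_ffact_bound q m; move: DU UD.
rewrite card_not_uniq mulnDl; lia.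
Qed.
End DescentCounts.

(** Reflecting [s + 1] exponents [y] to [q - 1 - y] turns [degx - degy = c q] into a total sum of
    [c q + (s + 1) (q - 1)]: increased by [s + 1], the total is [q (t + 1)]. *)
Lemma card_box (p e r s t : nat) (c : int) : c + s%:Z = t%:Z -> (s < p ^ e)%N ->
  #|[set w : {ffun 'I_(r.+1 + s.+1) -> 'I_(p ^ e)} |
      bidiff (box_mnm w) == - (c * (p ^ e)%N%:Z)]%SET| =
  #|[set y : (r + s + 1).-tuple 'I_(p ^ e) |
      ((s + \sum_(x <- y) (x : nat)) %/ (p ^ e) == t)%N]%SET|.
Proof.
set q := (p ^ e)%N => ct sq.
pose n := (r.+1 + s.+1)%N.
rewrite -(card_tuple_sum t sq (n := n)); last by rewrite /n; lia.
(* Reflecting the exponents of the y turns the condition on the difference of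
   the degrees into a condition on the sum of all exponents. *)
pose flip (w : {ffun 'I_n -> 'I_q}) : n.-tuple 'I_q :=
  [tuple if fintype.split i is inr _ then rev_ord (w i) else w i | i < n].
have flip_inj : injective flip.
  move=> w w' E; apply/ffunP => i; have := congr1 (fun z => tnth z i) E.
  by rewrite !tnth_mktuple; case: fintype.split => // _ /rev_ord_inj.
have flip_bij : bijective flip.
  apply: inj_card_bij => //.
  by rewrite card_tuple card_ffun !card_ord.
rewrite -[RHS](on_card_preimset (f := flip)); last exact: onW_bij.
apply: fintype.eq_card => w; rewrite !inE big_tuple big_split_ord.
have -> : (\sum_(i < r.+1) (tnth (flip w) (lshift s.+1 i) : nat) = degx (box_mnm w))%N.
  apply: eq_bigr => i _; rewrite tnth_mktuple box_mnmE.
  by rewrite (unsplitK (inl i)).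
set Y := (\sum_(i < s.+1) _)%N.
have YE : (Y + degy (box_mnm w) + s.+1 = s.+1 * q)%N.
  have sum_cst a : (s.+1 * a = \sum_(i < s.+1) a)%N.
    by rewrite sum_nat_const card_ord.
  rewrite -[X in (_ + X = _)%N]muln1 !sum_cst -!big_split; apply: eq_bigr => i _.
  rewrite /= tnth_mktuple box_mnmE (unsplitK (inr i)) /=.
  by move: (ltn_ord (w (rshift r.+1 i))); move: (nat_of_ord _) => a; lia.
rewrite -[_ (degx _) Y]/(degx (box_mnm w) + Y)%N /bidiff.
apply/eqP/eqP => E.
  move: E YE; move: (degx _) (degy _) => a b; nia.
move: E YE; move: (degx _) (degy _) => a b; nia.
Qed.

(** * The limit *)

Lemma cvg_geometric_bound (R : realType) (u : nat -> R) (l K z : R) (e0 : nat) :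
  0 <= z < 1 -> (forall e, (e0 <= e)%N -> `|u e - l| <= K * z ^+ e) ->
  u @ \oo --> l.
Proof.
move=> /andP[z0 z1] ul.
have Kz : (fun e => K * z ^+ e) @ \oo --> (0 : R).
  rewrite -(mulr0 K); apply: cvgMr; apply: cvg_expr; by rewrite ger0_norm.
apply: (@squeeze_cvgr _ _ _ _ (fun e => l - K * z ^+ e) (fun e => l + K * z ^+ e)).
- exists e0 => // e /= /ul; rewrite ler_norml => /andP[]; lra.
- by rewrite -[X in _ --> X]subr0; apply: cvgB => //; exact: cvg_cst.
- by rewrite -[X in _ --> X]addr0; apply: cvgD => //; exact: cvg_cst.
Qed.

Theorem proposition6p2 (R : realType) (k : closedFieldType) (p : nat)
  (pk : p \in [pchar k]) (r s : nat) (r_ge1 : (1 <= r)%N) (s_ge1 : (1 <= s)%N)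
  (c : int) (c_ge : - s%:Z <= c) (c_le : c <= r%:Z) :
  cvgn (F_ratio R pk (divisorial k (@class_divisor r s c))) /\
  generalized_F_signature R pk (divisorial k (@class_divisor r s c)) =
    (eulerian (absz (c + s%:Z + 1)) (r + s + 1))%:R / ((r + s + 1)`!)%:R.
Proof.
set u := F_ratio R pk _.
set A := eulerian _ _; set d := (r + s + 1)%N.
suff ul : u @ \oo --> (A%:R / (d`!)%:R : R).
  split; first by apply/cvg_ex; exists (A%:R / (d`!)%:R).
  by apply: cvg_lim => //; exact: Rhausdorff.
have p_gt1 : (1 < p)%N by rewrite prime_gt1 ?(pcharf_prime pk).
pose t := absz (c + s%:Z).
have ct : c + s%:Z = t%:Z by rewrite /t; lia.
(* [d ^ 2 + s] bounds the error in passing to injective words, and [A * d ^ 2] the one in replacing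
   the falling factorial by [q ^ d]. *)
pose K := (d ^ 2 + s + A * d ^ 2)%N.
(* The error is of order [1/q = p^-e]; from [e >= s] on, [s < p ^ e], so that [s] is a residue
   modulo [q]. *)
apply: (@cvg_geometric_bound _ u _ K%:R p%:R^-1 s).
  by rewrite invr_ge0 ler0n invf_lt1 ?ltr0n ?ltr1n // ltnW.
move=> e se; set q := (p ^ e)%N.
have sq : (s < q)%N by apply: leq_ltn_trans se (ltn_expl _ p_gt1).
have dE : d = (r + s).+1 by rewrite /d addn1.
set N := #|[set y : d.-tuple 'I_q | desc_from (Ordinal sq) y == t]%SET|.
have uE : u e = N%:R / q%:R ^+ d.
  rewrite /u /F_ratio multiplicityE // (card_box r ct sq) (card_tuple_desc t sq).
  by rewrite -natrX expnM natrX.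
have UE : #|[set y : d.-tuple 'I_q | uniq y && (desc_count (fun i => tnth y i) == t)]%SET|
    = ('C(q, d) * A)%N.
  rewrite card_arranged /A; congr (_ * eulerian _ _)%N; rewrite ct; lia.
(* The error bound multiplied by [d! q^d], stated in natural numbers; it relies on
   ['C(q, d) * d! = q ^_ d]. *)
have [lo hi] : (d`! * N <= q ^ d * A + d`! * (K * q ^ (r + s)))%N /\
    (q ^ d * A <= d`! * N + d`! * (K * q ^ (r + s)))%N.
  have := desc_from_bounds (r + s) t sq;  rewrite -dE UE -/N => -[NU UN].
  have := expn_ffact_bound q (r + s); rewrite -dE => bound.
  have ffact_le : (q ^_ d <= q ^ d)%N.
    by elim: (d) => // j IHj; rewrite ffactnSr expnSr leq_mul // leq_subr.
  have := bin_ffact q d; have := fact_gt0 d; rewrite /K.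
  move: bound ffact_le NU UN.
  move: (q ^ (r + s))%N (q ^ d)%N (q ^_ d)%N ('C(q, d)) (N) (d`!) (d ^ 2)%N.
  move=> Q X F C N' D d2 XF FX NU UN D0 CD.
  have h1 : (D * N' <= D * (C * A + (d2 + s) * Q))%N by rewrite leq_mul2l NU orbT.
  have h2 : (F * A <= X * A)%N by rewrite leq_mul2r FX orbT.
  have h3 : (X * A <= (F + d2 * Q) * A)%N by rewrite leq_mul2r XF orbT.
  have h4 : (D * (C * A) <= D * (N' + s * Q))%N by rewrite leq_mul2l UN orbT.
  have h5 : (A * d2 * Q <= D * (A * d2 * Q))%N by rewrite leq_pmull.
  rewrite -CD in h2 h3; split; nia.
have q0 : (0 < q%:R :> R) by rewrite ltr0n; lia.
have D0 : (0 < (d`!)%:R :> R) by rewrite ltr0n fact_gt0.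
have Kq : K%:R * p%:R^-1 ^+ e = K%:R * q%:R ^+ (r + s) / q%:R ^+ d :> R.
  rewrite exprVn -natrX -/q dE exprS; field.
  by rewrite expf_neq0 ?gt_eqF.
rewrite uE Kq ler_norml -!natrX.
have X0 : (0 < (q ^ d)%:R :> R) by rewrite natrX exprn_gt0.
move: lo hi X0 D0; move: (q ^ d)%N (q ^ (r + s))%N (d`!) (N) (K) => X Y D N' K'.
rewrite -!(ler_nat R) !(natrD, natrM) => lo hi X0 D0.
have -> : N'%:R / X%:R - A%:R / D%:R = (D%:R * N'%:R - X%:R * A%:R) / (D%:R * X%:R) :> R.
  by field; rewrite !gt_eqF.
have -> : K'%:R * Y%:R / X%:R = (D%:R * (K'%:R * Y%:R)) / (D%:R * X%:R) :> R.
  by field; rewrite !gt_eqF.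
rewrite -mulNr !ler_pM2r ?invr_gt0 ?mulr_gt0 //; apply/andP; split; lra.
Qed.
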